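(* For every integer $p > 1$, the following problem can be solved in polynomial time: given a chordal graph $G$, find a minimum set $V_-\subseteq V(G)$ such that $G - V_-$ contains no clique on $p$ vertices.
   Context: All graphs are finite, simple and undirected. A graph is chordal if every cycle of length greater than three has a chord. $K_p$ denotes the complete graph on $p$ vertices, and a graph is $K_p$-free if it has no induced (equivalently, no) subgraph isomorphic to $K_p$. *)

(* Defs.v *)
From HB Require Import structures.
From mathcomp Require Import all_boot.

Set Implicit Arguments.
Unset Strict Implicit.
Unset Printing Implicit Defensive.

Record sgraph := SGraph {
  vertex :> finType;
  adj : rel vertex;
  adj_sym : symmetric adj;
  adj_irr : irreflexive adj
}.

(* [c] lists the vertices of a cycle in order; a chord is an edge between two
   vertices that are not consecutive on [c]. *)
Definition chordal (G : sgraph) : Prop :=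
  forall c : seq G, ucycle (@adj G) c -> 3 < size c ->
  exists x y : G, [/\ x \in c, y \in c, adj x y, next c x != y & next c y != x].

Definition clique (G : sgraph) (K : {set G}) : Prop :=
  {in K &, forall x y, x != y -> adj x y}.

Definition has_clique (G : sgraph) (p : nat) : Prop :=
  exists K : {set G}, clique K /\ #|K| = p.

Definition del_adj (G : sgraph) (V : {set G}) : rel {x : G | x \notin V} :=
  fun x y => adj (val x) (val y).

Lemma del_adj_sym (G : sgraph) (V : {set G}) : symmetric (@del_adj G V).
Proof. by move=> x y; apply: adj_sym. Qed.

Lemma del_adj_irr (G : sgraph) (V : {set G}) : irreflexive (@del_adj G V).
Proof. by move=> x; apply: adj_irr. Qed.

Definition del_vertices (G : sgraph) (V : {set G}) : sgraph :=
  SGraph (@del_adj_sym G V) (@del_adj_irr G V).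

Definition clique_deletion_set (p : nat) (G : sgraph) (V : {set G}) : Prop :=
  ~ has_clique (del_vertices V) p.

Definition min_clique_deletion_set (p : nat) (G : sgraph) (V : {set G}) : Prop :=
  clique_deletion_set p V /\
  forall W : {set G}, clique_deletion_set p W -> #|V| <= #|W|.

(* Adjacency matrix in row-major order, and characteristic vector. *)
Definition encode_graph (G : sgraph) : seq bool :=
  [seq adj x y | x <- enum G, y <- enum G].

Definition encode_vset (G : sgraph) (V : {set G}) : seq bool :=
  [seq x \in V | x <- enum G].

(* The random access machine of Cook and Reckhow (Time bounded random access
   machines, 1973), over nat with truncated subtraction. One step costs one time
   unit; since there is no multiplication, t steps only produce numbers of O(t)
   bits, so polynomial time in this sense is polynomial time on Turing
   machines. *)
Inductive instr :=
  | IConst of nat & nat (* X_i := c *)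
  | IAdd of nat & nat & nat (* X_i := X_j + X_k *)
  | ISub of nat & nat & nat (* X_i := X_j - X_k *)
  | IGet of nat & nat (* X_i := X_(X_j) *)
  | IPut of nat & nat (* X_(X_i) := X_j *)
  | IJump of nat & nat (* go to instruction m if X_j > 0 *)
  | IRead of nat (* X_i := next input bit, 2 if none is left *)
  | IPrint of nat. (* output the bit X_i > 0 *)

Definition program := seq instr.

Record config := Config {
  pc : nat;
  reg : nat -> nat;
  input : seq bool;
  output : seq bool
}.

Definition initial (w : seq bool) : config := Config 0 (fun=> 0) w [::].

Definition set_reg (r : nat -> nat) (i v : nat) : nat -> nat :=
  fun j => if j == i then v else r j.

Definition exec (c : config) (a : instr) : config :=
  let: Config l r x y := c in
  match a with
  | IConst i n => Config l.+1 (set_reg r i n) x y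
  | IAdd i j k => Config l.+1 (set_reg r i (r j + r k)) x y
  | ISub i j k => Config l.+1 (set_reg r i (r j - r k)) x y
  | IGet i j => Config l.+1 (set_reg r i (r (r j))) x y
  | IPut i j => Config l.+1 (set_reg r (r i) (r j)) x y
  | IJump m j => Config (if 0 < r j then m else l.+1) r x y
  | IRead i =>
      let b := if x is b :: _ then nat_of_bool b else 2 in
      Config l.+1 (set_reg r i b) (behead x) y
  | IPrint i => Config l.+1 r x (rcons y (0 < r i))
  end.

(* The machine halts when the program counter leaves the program. *)
Definition step (P : program) (c : config) : config :=
  if onth P (pc c) is Some a then exec c a else c.

Definition computes_in (P : program) (w : seq bool) (t : nat) (z : seq bool) :
    Prop :=
  let c := iter t (step P) (initial w) in size P <= pc c /\ output c = z.

(* Search problem: given an instance [i] satisfying [promise], return the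
   encoding of some [s] with [sol i s]. *)
Definition poly_time_solvable (I : Type) (S : I -> Type)
    (encI : I -> seq bool) (encS : forall i, S i -> seq bool)
    (promise : I -> Prop) (sol : forall i, S i -> Prop) : Prop :=
  exists (P : program) (c k : nat), forall i : I, promise i ->
  exists (t : nat) (s : S i),
    [/\ t <= c * size (encI i) ^ k + c,
        computes_in P (encI i) t (encS i s) & sol i s].

(* Main.v *)
Require Import Defs.
From HB Require Import structures.
From mathcomp Require Import all_boot zify.

Set Implicit Arguments.
Unset Strict Implicit.
Unset Printing Implicit Defensive.

(* Every nonempty vertex set of a chordal graph contains a simplicial vertex,
   so with t = p - 1 a vertex set has no clique on p vertices exactly when it
   can be coloured with t colours. The largest t-colourable induced subgraph
   is found by dynamic programming along a simplicial elimination. The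
   eliminated vertices form blocks, each attached to the remaining graph by a
   clique, namely the remaining neighbours of its root; that clique contains
   at most one vertex of each colour, so what a block has to know of the
   colouring outside it is one of polynomially many t-tuples of vertices. A
   minimum deletion set is then found greedily: a vertex is deleted for good
   whenever this does not lower the optimum of the remaining graph. The
   algorithm is written in a small language in which every loop runs over the
   numbers below N = (input length) + 4, so that the running time of its
   compiled code has a polynomial bound by induction on the syntax. *)

(** * Simplicial vertices of chordal graphs *)

Definition simplicial (G : sgraph) (A : {set G}) (v : G) : Prop :=
  clique [set a in A | adj v a].

Lemma simplicialW (G : sgraph) (A B : {set G}) v :
  A \subset B -> simplicial B v -> simplicial A v.
Proof.
move=> /subsetP AB clB a b; rewrite !inE => /andP[/AB aB va] /andP[/AB bB vb].
by apply: clB; rewrite inE ?aB ?bB.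
Qed.

Definition nonadjacent_neighbours (G : sgraph) (A : {set G}) (v : G) : bool :=
  [exists x, exists y, [&& (x \in A) && adj v x, (y \in A) && adj v y, x != y &
    ~~ adj x y]].

Lemma simplicialP (G : sgraph) (A : {set G}) v :
  reflect (simplicial A v) (~~ nonadjacent_neighbours A v).
Proof.
apply: (iffP idP) => [/existsPn simpv x y|simpv].
  rewrite !inE => vx vy xy; have /existsPn/(_ y) := simpv x.
  by rewrite vx vy xy negbK.
apply/existsPn => x; apply/existsPn => y.
apply/negP => /and4P[vx vy xy /negP[]].
by apply: simpv xy; rewrite inE.
Qed.

Lemma next_nth_uniq (T : eqType) (y : T) s i :
  uniq (y :: s) -> i <= size s -> next (y :: s) (nth y (y :: s) i) = nth y s i.
Proof. by move=> Us lei; rewrite next_nth mem_nth // index_uniq. Qed.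

Lemma path_shortcut (T : eqType) (e : rel T) x q i j :
  i.+1 < j <= size q -> e (nth x (x :: q) i) (nth x (x :: q) j) -> path e x q ->
  let q' := take i q ++ drop j.-1 q in
  [/\ path e x q', last x q' = last x q, size q' < size q & {subset q' <= q}].
Proof.
case: j => [|j] /andP[ltij ltj] //= eij pathq.
have pathl := take_path i pathq.
have pathr : path e (last x (take j q)) (drop j q).
  by rewrite -(cat_take_drop j q) cat_path in pathq; case/andP: pathq.
have lasti : last x (take i q) = nth x (x :: q) i.
  rewrite (last_nth x) size_takel; last by lia.
  by case: (i) => //= k; rewrite nth_take.
rewrite (drop_nth x) //= in pathr *; case/andP: pathr => _ pathr; split.
- by rewrite cat_path pathl lasti /= eij.
- rewrite last_cat -[in RHS](cat_take_drop j q) last_cat.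
  by rewrite [in RHS](drop_nth x).
- by rewrite size_cat /= size_takel ?size_drop; lia.
- by move=> z; rewrite mem_cat -drop_nth // => /orP[/mem_take|/mem_drop].
Qed.

Lemma chordless_path (T : eqType) (e : rel T) x q : path e x q ->
  exists q', [/\ path e x q', last x q' = last x q, {subset q' <= q},
    uniq (x :: q') & forall i j, i.+1 < j <= size q' ->
      ~~ e (nth x (x :: q') i) (nth x (x :: q') j)].
Proof.
have [m] := ubnP (size q); elim: m q => // m IHm q; rewrite ltnS => leqm pathq.
have [p [pathp lastp subp Up lepq]] : exists p, [/\ path e x p,
    last x p = last x q, {subset p <= q}, uniq (x :: p) & size p <= size q].
  case: (shortenP pathq) => p pathp Up subp; exists p; split=> //.
  by apply: uniq_leq_size => //; case/andP: Up.
pose n := (size p).+1.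
have [/existsP[i /existsP[j /andP[ltij eij]]]|] :=
  boolP [exists i : 'I_n, exists j : 'I_n,
    (i.+1 < j) && e (nth x (x :: p) i) (nth x (x :: p) j)].
  have lej : i.+1 < j <= size p by rewrite ltij -ltnS ltn_ord.
  have [path' last' size' sub'] := path_shortcut lej eij pathp.
  have [|q' [? lastq' subq' ? ?]] := IHm _ _ path'; first by lia.
  exists q'; split=> //; first by rewrite lastq' last'.
  by move=> z /subq'/sub'/subp.
move=> /existsPn nochord; exists p; split=> // i j /andP[ltij lej].
have ltjn : j < n by []; have ltin := ltn_trans (ltnW ltij) ltjn.
have /existsPn/(_ (Ordinal ltjn)) := nochord (Ordinal ltin).
by rewrite negb_and ltij.
Qed.

(* Shorten [q] to a chordless path [p]. On the cycle [u :: x :: p] the only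
   neighbours of [u] are [x] and [y], so the cycle has no chord and is a
   triangle. *)
Lemma chordal_bypass (G : sgraph) (u x y : G) (q : seq G) :
  chordal G -> adj u x -> adj u y -> x != y ->
  path (@adj G) x q -> last x q = y ->
  u \notin q -> {in q, forall z, adj u z -> z = y} -> adj x y.
Proof.
move=> chG ux uy xy /chordless_path[p [pathp <- subp Up chordless]] lasty.
move=> uq nbr; have [lep1|lt1p] := leqP (size p) 1.
  case: p pathp lasty {subp Up chordless} lep1 => [_ E|z [|//] pathp <- _].
    by rewrite -E eqxx in xy.
  by case/andP: pathp.
pose c := u :: x :: p.
have Uc : uniq c.
  rewrite /c cons_uniq Up andbT inE negb_or (contra (subp u) uq) andbT.
  by apply: contraTneq ux => <-; rewrite adj_irr.
have cycc : ucycle (@adj G) c.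
  by rewrite /ucycle Uc andbT /= ux rcons_path pathp lasty adj_sym.
have no_chord i j : i < j < size c -> adj (nth u c i) (nth u c j) ->
    (next c (nth u c i) == nth u c j) || (next c (nth u c j) == nth u c i).
  case/andP=> ltij ltj; rewrite !next_nth_uniq //; last exact: ltn_trans ltj.
  case: i j ltij ltj => [|i] [|[|j]] //; rewrite ?eqxx // => ltij ltj aij.
    have jy : nth u p j = y by apply: nbr aij; apply/subp/mem_nth.
    have : nth u (x :: p) j.+1 == nth u (x :: p) (size p).
      by rewrite -last_nth lasty /= jy.
    rewrite nth_uniq // => /eqP jp; apply/orP; right.
    by rewrite nth_default //= jp.
  have [<-|nij] := eqVneq i j; first by rewrite eqxx.
  have ltij' : i.+1 < j.+1 <= size p by move: ltij ltj; rewrite /= !ltnS; lia.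
  have := chordless i j.+1 ltij'; rewrite !(set_nth_default u x) //=.
    by case/negP.
  by case/andP: ltij' => lti lej; apply/leqW/ltnW/(leq_trans lti).
have [//|a [b [/(nthP u)[i lti <-] /(nthP u)[j ltj <-] aij]]] := chG c cycc.
move=> /negPf nij /negPf nji; have := no_chord i j; have := no_chord j i.
rewrite lti ltj !andbT adj_sym aij nij nji.
case: ltngtP => [_ /(_ isT isT)//|_ _ /(_ isT isT)//|eij].
by rewrite eij adj_irr in aij.
Qed.

Definition connected_in (G : sgraph) (C : {set G}) : bool :=
  [forall x in C, forall y in C, connect [rel a b in C | adj a b] x y].

Lemma connected_in1 (G : sgraph) (x : G) : connected_in [set x].
Proof.
apply/forall_inP => a /set1P->; apply/forall_inP => b /set1P->.
exact: connect0.
Qed.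

Lemma connected_inU1 (G : sgraph) (C : {set G}) b c :
  connected_in C -> c \in C -> adj c b -> connected_in (b |: C).
Proof.
move=> conC cC cb; pose r := [rel x y in b |: C | adj x y].
have r_sym : connect_sym r.
  by apply: sym_connect_sym => x y /=; rewrite adj_sym [(x \in _) && _]andbC.
have to_c x : x \in b |: C -> connect r x c.
  case/setU1P => [->|xC].
    by apply: connect1; rewrite /= setU11 setU1r // adj_sym.
  have /forall_inP/(_ x xC)/forall_inP/(_ c cC) := conC.
  apply: connect_sub => y z /= /andP[/andP[yC zC] yz].
  by apply: connect1; rewrite /= !setU1r.
apply/forall_inP => x /to_c xc; apply/forall_inP => y /to_c.
by rewrite r_sym; apply: connect_trans xc.
Qed.

Definition neighbours (G : sgraph) (A C : {set G}) : {set G} :=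
  [set b in A :\: C | [exists c in C, adj b c]].

Definition anticomplete (G : sgraph) (C : {set G}) (u : G) : bool :=
  (u \notin C) && [forall c in C, ~~ adj u c].

Lemma anticompleteP (G : sgraph) (C : {set G}) u :
  reflect (u \notin C /\ {in C, forall c, ~~ adj u c}) (anticomplete C u).
Proof. by apply: (iffP andP) => -[uC /forall_inP]. Qed.

Lemma neighboursP (G : sgraph) (A C : {set G}) b :
  reflect [/\ b \in A, b \notin C & exists2 c, c \in C & adj b c]
    (b \in neighbours A C).
Proof.
rewrite inE; apply: (iffP andP) => [[/setDP[bA bC] /exists_inP]|[bA bC nbr]] //.
by rewrite inE bA bC; split=> //; apply/exists_inP.
Qed.

Lemma chordal_attachment_clique (G : sgraph) (A C : {set G}) u :
  chordal G -> connected_in C -> anticomplete C u ->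
  {in neighbours A C, forall b, adj u b} -> clique (neighbours A C).
Proof.
move=> chG /forall_inP conC /anticompleteP[uC uNC] uB x y xB yB xy.
have /neighboursP[_ _ [c cC xc]] := xB; have /neighboursP[_ _ [d dC yd]] := yB.
have /forall_inP/(_ d dC)/connectP[p pathp lastd] := conC c cC.
have subC : {subset c :: p <= C}.
  move=> z; rewrite inE => /predU1P[-> //|zp].
  suff /allP : all (mem C) p by apply.
  elim: p (c) pathp {lastd zp} => //= a p IHp b.
  by case/andP=> /andP[/andP[_ ->] _] /IHp.
have uy := uB y yB.
apply: (@chordal_bypass _ u x y (rcons (c :: p) y)) => //; first exact: uB.
- rewrite rcons_path /= -lastd [adj d y]adj_sym yd xc andbT /=.
  by apply: sub_path pathp => a b /andP[].
- by rewrite last_rcons.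
- rewrite mem_rcons inE negb_or (contra (subC u) uC) andbT.
  by apply: contraTneq uy => <-; rewrite adj_irr.
- move=> z; rewrite mem_rcons inE => /predU1P[//|/subC/uNC/negP//].
Qed.

(* [C] is maximal among the connected sets with an anticomplete vertex: if
   [~~ adj z b], then [z] would still be anticomplete to [b |: C]. *)
Lemma maximal_anticomplete (G : sgraph) (A : {set G}) x y :
  x \in A -> y \in A -> x != y -> ~~ adj x y ->
  exists C : {set G}, [/\ C \subset A, connected_in C, C != set0,
    exists2 u, u \in A & anticomplete C u &
    {in A, forall z, anticomplete C z ->
      {in neighbours A C, forall b, adj z b}}].
Proof.
move=> xA yA xy nxy; pose separated (C : {set G}) :=
  [&& C \subset A, connected_in C, C != set0 &
    [exists u in A, anticomplete C u]].
have sepx : separated [set x].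
  rewrite /separated sub1set xA connected_in1 -card_gt0 cards1 /=.
  apply/exists_inP; exists y => //; apply/anticompleteP.
  by rewrite inE eq_sym; split=> // c /set1P->; rewrite adj_sym.
have [C /maxsetP[/and4P[CA conC nzC /exists_inP anti] maxC] _] :=
  maxset_exists (P := separated) sepx.
exists C; split=> // z zA zC b /neighboursP[bA bC [c cC bc]].
apply: contraR bC => zb; rewrite -(maxC (b |: C)) ?setU11 ?subsetUr //.
apply/and4P; split.
- by rewrite subUset sub1set bA.
- by apply: (connected_inU1 conC cC); rewrite adj_sym.
- by apply/set0Pn; exists b; rewrite setU11.
- apply/exists_inP; exists z => //; have [zC' zNC] := anticompleteP _ _ zC.
  apply/anticompleteP; split=> [|d /setU1P[->//|/zNC//]].
  by rewrite !inE negb_or zC' andbT; apply: contraTneq bc => <-; rewrite zNC.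
Qed.

(* In a chordal graph the neighbourhood of the set [C] of [maximal_anticomplete]
   is a clique, complete to the vertices that are anticomplete to [C]; a vertex
   simplicial among the latter is simplicial in [A]. *)
Lemma chordal_simplicial (G : sgraph) (A : {set G}) :
  chordal G -> A != set0 -> exists2 v, v \in A & simplicial A v.
Proof.
move=> chG; have [m] := ubnP #|A|; elim: m A => // m IHm A ltA /set0Pn[a aA].
have [/exists_inP[x xA /exists_inP[y yA /andP[xy nxy]]]|complete] :=
  boolP [exists x in A, exists y in A, (x != y) && ~~ adj x y]; last first.
  exists a => // b c; rewrite !inE => /andP[bA _] /andP[cA _] bc.
  apply: contraR complete => nbc; apply/exists_inP; exists b => //.
  by apply/exists_inP; exists c; rewrite ?bc.
have [C [CA conC /set0Pn[c cC] [u uA uC] complB]] :=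
  maximal_anticomplete xA yA xy nxy.
pose B := neighbours A C; pose X := [set z in A | anticomplete C z].
have clB : clique B.
  exact: chordal_attachment_clique conC uC (complB u uA uC).
have [||v] := IHm X.
- rewrite -ltnS; apply: leq_trans ltA; rewrite ltnS; apply: proper_card.
  apply/properP; split; first by apply/subsetP => z; rewrite inE => /andP[].
  by exists c; [exact: (subsetP CA) | rewrite inE /anticomplete cC andbF].
- by apply/set0Pn; exists u; rewrite inE uA.
rewrite inE => /andP[vA vC] simpv; exists v => //.
have [_ vNC] := anticompleteP _ _ vC.
have XB z : z \in A -> adj v z -> (z \in X) || (z \in B).
  move=> zA vz; have zC : z \notin C by apply: contraTN vz => /vNC.
  rewrite !inE zA zC /anticomplete zC /= -negb_exists_in.
  exact: orNb.
move=> y1 y2; rewrite !inE => /andP[y1A vy1] /andP[y2A vy2] y12.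
case/orP: (XB _ y1A vy1) (XB _ y2A vy2) => [y1X|y1B] /orP[y2X|y2B].
- by apply: simpv y12; rewrite inE ?y1X ?y2X.
- by move: y1X; rewrite inE => /andP[_ y1C]; apply: complB.
- by move: y2X; rewrite inE => /andP[_ y2C]; rewrite adj_sym complB.
- exact: clB y12.
Qed.

(** * Maximum list colourings *)

Section ListColouring.

Variables (G : sgraph) (t : nat).

Implicit Types (L : G -> pred 'I_t) (U : {set G}).
Implicit Types (c : {ffun G -> option 'I_t}).

Definition coloured c : {set G} := [set u | c u].

Definition list_colouring L U c : bool :=
  [forall u, forall j, (c u == Some j) ==>
    [&& u \in U, L u j & [forall v, adj u v ==> (c v != Some j)]]].

Definition max_colourable L U : nat :=
  \max_(c | list_colouring L U c) #|coloured c|.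

Lemma list_colouringP L U c :
  reflect (forall u j, c u = Some j ->
    [/\ u \in U, L u j & forall v, adj u v -> c v <> Some j])
  (list_colouring L U c).
Proof.
apply: (iffP forallP) => [cP u j cu|cP u]; last first.
  apply/forallP => j; apply/implyP => /eqP/cP[-> -> nbr] /=.
  by apply/forall_inP => v /nbr/eqP.
have /forallP/(_ j) := cP u; rewrite cu eqxx => /and3P[uU uj /forall_inP nbr].
by split=> // v /nbr/eqP.
Qed.

Lemma colouredP c u : reflect (exists j, c u = Some j) (u \in coloured c).
Proof. by rewrite inE; case: (c u) => [j|]; constructor; [exists j | case]. Qed.

Lemma coloured_sub L U c : list_colouring L U c -> coloured c \subset U.
Proof.
by move=> /list_colouringP cP; apply/subsetP => u /colouredP[j /cP[]].
Qed.

Lemma leq_max_colourable L U c :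
  list_colouring L U c -> #|coloured c| <= max_colourable L U.
Proof. exact: (@leq_bigmax_cond _ _ (fun c => #|coloured c|)). Qed.

Lemma max_colourable_attained L U :
  exists2 c, list_colouring L U c & #|coloured c| = max_colourable L U.
Proof.
pose blank : {ffun G -> option 'I_t} := [ffun=> None].
have blankP : list_colouring L U blank.
  by apply/list_colouringP => u j; rewrite ffunE.
have colouringT : 0 < #|list_colouring L U| by apply/card_gt0P; exists blank.
have [c cP cE] := eq_bigmax_cond (fun c => #|coloured c|) colouringT.
by exists c; rewrite // -cE.
Qed.

Lemma list_colouringW L L' U U' c :
  {in U, forall u, subpred (L u) (L' u)} -> U \subset U' ->
  list_colouring L U c -> list_colouring L' U' c.
Proof.
move=> LL' /subsetP UU' /list_colouringP cP.
apply/list_colouringP => u j /cP[uU uj nbr].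
by split; [exact: UU' | exact: LL' |].
Qed.

Lemma max_colourableW L L' U U' :
  {in U, forall u, subpred (L u) (L' u)} -> U \subset U' ->
  max_colourable L U <= max_colourable L' U'.
Proof.
move=> LL' UU'; have [c cP <-] := max_colourable_attained L U.
exact/leq_max_colourable/(list_colouringW LL' UU').
Qed.

Lemma eq_max_colourable L L' U :
  {in U, forall u, L u =1 L' u} -> max_colourable L U = max_colourable L' U.
Proof.
move=> LL'; apply/eqP.
by rewrite eqn_leq !max_colourableW // => u uU j; rewrite LL'.
Qed.

Lemma max_colourable_leq_card L U : max_colourable L U <= #|U|.
Proof.
have [c /coloured_sub cU <-] := max_colourable_attained L U.
exact: subset_leq_card.
Qed.

Lemma max_colourable0 L : max_colourable L set0 = 0.
Proof. by apply/eqP; rewrite -leqn0 -(cards0 G) max_colourable_leq_card. Qed.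

Lemma card_coloured_partition (I : finType) (f : G -> I) c :
  #|coloured c| = \sum_i #|[set u in coloured c | f u == i]|.
Proof.
rewrite -sum1_card (partition_big f predT) //=; apply: eq_bigr => i _.
by rewrite -sum1_card; apply: eq_bigl => u; rewrite !inE.
Qed.

Lemma max_colourable_partition (I : finType) (f : G -> I) L U :
  {in U &, forall u v, adj u v -> f u = f v} ->
  max_colourable L U = \sum_i max_colourable L [set u in U | f u == i].
Proof.
move=> fE; apply/eqP; rewrite eqn_leq; apply/andP; split.
  have [c cP <-] := max_colourable_attained L U.
  rewrite (card_coloured_partition f); apply: leq_sum => i _.
  pose part := [ffun u => if f u == i then c u else None].
  have -> : [set u in coloured c | f u == i] = coloured part.
    by apply/setP => u; rewrite !inE ffunE; case: eqP; rewrite ?andbT ?andbF.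
  apply/leq_max_colourable/list_colouringP => u j.
  rewrite ffunE; case: eqP => // fu /(list_colouringP _ _ _ cP)[uU uj nbr].
  by rewrite inE uU fu eqxx; split=> // v /nbr; rewrite ffunE; case: ifP.
have [c cP cE] := fin_all_exists2
  (fun i => max_colourable_attained L [set u in U | f u == i]).
pose glue := [ffun u => c (f u) u].
have glueP u j : glue u = Some j ->
    [/\ u \in U, L u j & forall v, adj u v -> c (f u) v <> Some j].
  rewrite ffunE => /(list_colouringP _ _ _ (cP _))[].
  by rewrite inE => /andP[].
have <- : #|coloured glue| = \sum_i max_colourable L [set u in U | f u == i].
  rewrite (card_coloured_partition f); apply: eq_bigr => i _; rewrite -cE.
  apply: eq_card => u; rewrite !inE ffunE.
  apply/andP/idP => [[cu /eqP <-] //|cu].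
  have /subsetP/(_ u) := coloured_sub (cP i).
  by rewrite !inE cu => /(_ isT)/andP[_ /eqP fu]; rewrite fu.
apply/leq_max_colourable/list_colouringP => u j gu.
have [uU uj nbr] := glueP u j gu; split=> // v uv gv.
have [vU _ _] := glueP v j gv.
by apply: (nbr v uv); move: gv; rewrite ffunE (fE u v).
Qed.

Definition recolour c v o := [ffun u => if u == v then o else c u].

Lemma card_coloured_recolour c v :
  #|coloured c| = c v + #|coloured (recolour c v None)|.
Proof.
rewrite (cardsD1 v) inE; congr (_ + _); apply: eq_card => u.
by rewrite !inE ffunE; case: eqP.
Qed.

Definition forbid L (v : G) (j : 'I_t) : G -> pred 'I_t :=
  fun u i => L u i && ~~ ((i == j) && adj v u).

Lemma list_colouring_erase L U v j c :
  list_colouring L (v |: U) c -> c v = Some j ->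
  list_colouring (forbid L v j) U (recolour c v None).
Proof.
move=> /list_colouringP cP cv; apply/list_colouringP => u i.
rewrite ffunE; case: eqP => // /eqP uv cu; have [uU ui nbr] := cP u i cu.
move: uU; rewrite !inE (negPf uv) => uU; split=> // [|w /nbr]; last first.
  by rewrite ffunE; case: eqP.
rewrite /forbid ui; apply/negP => /andP[/eqP ij vu].
by apply: (nbr v); rewrite ?ij // adj_sym.
Qed.

Lemma list_colouring_extend L U v j c : L v j ->
  list_colouring (forbid L v j) U c ->
  list_colouring L (v |: U) (recolour c v (Some j)).
Proof.
move=> vj /list_colouringP cP.
have nbr u : adj v u -> c u <> Some j.
  by move=> vu /cP[_ + _]; rewrite /forbid eqxx vu andbF.
apply/list_colouringP => u i; rewrite ffunE; case: eqP => [-> [<-]|/eqP uv cu].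
  rewrite setU11; split=> // w vw; rewrite ffunE.
  by case: eqP => [wv|_]; [rewrite wv adj_irr in vw | apply: nbr].
have [uU /andP[ui _] nbru] := cP u i cu; split=> //; first by rewrite setU1r.
move=> w uw; rewrite ffunE; case: eqP => [wv [ij]|_]; last exact: nbru.
by apply: (nbr u); rewrite -?wv 1?adj_sym // ij.
Qed.

Lemma max_colourable_setU1 L U v : v \notin U ->
  max_colourable L (v |: U) =
  maxn (max_colourable L U)
    (\max_(j | L v j) (max_colourable (forbid L v j) U).+1).
Proof.
move=> vU; apply/eqP; rewrite eqn_leq geq_max; apply/and3P; split.
- have [c cP <-] := max_colourable_attained L (v |: U).
  rewrite (card_coloured_recolour c v) leq_max; case cv: (c v) => [j|].
    have [_ vj _] := list_colouringP _ _ _ cP v j cv.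
    apply/orP; right; apply: leq_trans (leq_bigmax_cond _ vj).
    exact: leq_max_colourable (list_colouring_erase cP cv).
  apply/orP; left; apply: leq_max_colourable; apply/list_colouringP => u j.
  rewrite ffunE; case: eqP => // /eqP uv /(list_colouringP _ _ _ cP)[uU uj nbr].
  move: uU; rewrite !inE (negPf uv); split=> // w /nbr.
  by rewrite ffunE; case: eqP.
- by apply: max_colourableW (subsetUr _ _) => u _ j.
- apply/bigmax_leqP => j vj.
  have [c cP <-] := max_colourable_attained (forbid L v j) U.
  apply: leq_trans (leq_max_colourable (list_colouring_extend vj cP)).
  rewrite [leqRHS](card_coloured_recolour _ v) ffunE eqxx ltnS.
  apply/subset_leq_card/subsetP => u cu.
  have uU : u \in U by apply: subsetP cu; apply: coloured_sub cP.
  by move: cu; rewrite !inE !ffunE; case: eqP => // uv; rewrite -uv uU in vU.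
Qed.

Lemma card_some_ord : #|[set Some j | j : 'I_t]| = t.
Proof. by rewrite card_imset ?cardsT ?card_ord //; apply: Some_inj. Qed.

Definition unrestricted : G -> pred 'I_t := fun _ => predT.

Lemma clique_leq_colours U : max_colourable unrestricted U = #|U| ->
  forall K : {set G}, K \subset U -> clique K -> #|K| <= t.
Proof.
have [c cP <-] := max_colourable_attained unrestricted U => cU.
have colU : coloured c = U.
  by apply/eqP; rewrite eqEcard (coloured_sub cP) cU leqnn.
move=> K /subsetP KU clK; rewrite -card_some_ord.
have cK : {in K &, injective c}.
  move=> u v uK vK cuv; apply: contraTeq isT => uv.
  have /colouredP[j cu] : u \in coloured c by rewrite colU KU.
  have [_ _ /(_ v (clK _ _ uK vK uv))] := list_colouringP _ _ _ cP u j cu.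
  by rewrite -cuv cu.
rewrite -(card_in_imset cK).
apply/subset_leq_card/subsetP => _ /imsetP[u uK ->].
have /colouredP[j ->] : u \in coloured c by rewrite colU KU.
exact: imset_f.
Qed.

Lemma chordal_colourable U : chordal G ->
  (forall K : {set G}, K \subset U -> clique K -> #|K| <= t) ->
  max_colourable unrestricted U = #|U|.
Proof.
move=> chG; have [m] := ubnP #|U|; elim: m U => // m IHm U ltU smallK.
have [->|nzU] := eqVneq U set0; first by rewrite max_colourable0 cards0.
have [v vU simpv] := chordal_simplicial chG nzU.
pose M := [set a in U | adj v a].
have clM : clique (v |: M).
  move=> a b /setU1P[->|aM] /setU1P[->|bM] ab; first by rewrite eqxx in ab.
  - by move: bM; rewrite inE => /andP[].
  - by move: aM; rewrite inE adj_sym => /andP[].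
  - exact: simpv.
have ltM : #|M| < t.
  have := smallK (v |: M) _ clM; rewrite cardsU1 inE adj_irr andbF; apply.
  by apply/subsetP => a; rewrite !inE => /predU1P[->|/andP[]].
have IHv : max_colourable unrestricted (U :\ v) = #|U :\ v|.
  apply: IHm => [|K KU]; last exact/smallK/(subset_trans KU)/subD1set.
  by move: ltU; rewrite (cardsD1 v U) vU.
have [c cP cE] := max_colourable_attained unrestricted (U :\ v).
have /subsetPn[_ /imsetP[j _ ->] freej] :
    ~~ ([set Some j | j : 'I_t] \subset c @: M).
  apply: contraL ltM => /subset_leq_card; rewrite card_some_ord -leqNgt.
  by move/leq_trans; apply; apply: leq_imset_card.
apply/eqP; rewrite eqn_leq max_colourable_leq_card -{1 2}(setD1K vU).
rewrite max_colourable_setU1 ?setD11 // cardsU1 setD11.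
rewrite leq_max (bigmax_sup j) ?orbT // ltnS -IHv -cE.
apply/leq_max_colourable/list_colouringP => u i cu.
have [uU _ nbr] := list_colouringP _ _ _ cP u i cu; split=> //.
apply/negP => /andP[/eqP ij vu]; case/imsetP: freej.
exists u; last by rewrite cu ij.
by move: uU; rewrite !inE vu andbT => /andP[].
Qed.

End ListColouring.

(** * Clique deletion sets of chordal graphs *)

Lemma has_clique_del_vertices (G : sgraph) (V : {set G}) p :
  has_clique (del_vertices V) p <->
  exists K : {set G}, [/\ K \subset ~: V, clique K & #|K| = p].
Proof.
split=> [[K [clK cardK]]|[K [/subsetP KV clK cardK]]].
  exists (val @: K); split; last by rewrite card_imset //; apply: val_inj.
    by apply/subsetP => _ /imsetP[x _ ->]; rewrite inE (valP x).
  move=> _ _ /imsetP[x xK ->] /imsetP[y yK ->]; rewrite val_eqE.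
  exact: clK.
exists [set x | val x \in K]; split.
  move=> x y; rewrite !inE => xK yK; rewrite -val_eqE; exact: clK.
rewrite -cardK -(card_imset _ val_inj); apply: eq_card => x.
apply/imsetP/idP => [[y + ->]|xK]; first by rewrite inE.
have xV : x \notin V by have := KV x xK; rewrite inE.
by exists (exist _ x xV); rewrite // inE.
Qed.

Lemma clique_deletion_set_colourable (G : sgraph) t (V : {set G}) : chordal G ->
  clique_deletion_set t.+1 V <->
  max_colourable (@unrestricted G t) (~: V) = #|~: V|.
Proof.
move=> chG; rewrite /clique_deletion_set has_clique_del_vertices.
split=> [free|colV [K [KV clK cardK]]]; last first.
  by have := clique_leq_colours colV KV clK; rewrite cardK ltnn.
apply: chordal_colourable => // K KV clK; rewrite leqNgt; apply/negP.
case/card_geqP=> s [Us sizes /subsetP sK]; apply: free; exists [set x in s].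
have {}sK : [set x in s] \subset K.
  by apply/subsetP => x; rewrite inE => /(subsetP sK).
split; first exact: subset_trans KV.
  by move=> x y /(subsetP sK) xK /(subsetP sK); apply: clK.
by rewrite cardsE -sizes; apply/card_uniqP.
Qed.

Definition critical (T : finType) (f : {set T} -> nat) (S D : {set T}) : Prop :=
  f D = f set0 /\ {in S, forall u, u \notin D -> f (u |: D) < f set0}.

Lemma criticalU1 (T : finType) (f : {set T} -> nat) (S D : {set T}) u :
  {homo f : A B / A \subset B >-> B <= A} -> critical f S D ->
  critical f (u |: S) (if f (u |: D) < f set0 then D else u |: D).
Proof.
move=> anti [fD critD]; case: ltnP => [ltu|geu].
  by split=> // v /setU1P[->|/critD].
split.
  by apply/eqP; rewrite eqn_leq geu andbT anti ?sub0set.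
move=> v /setU1P[->|vS]; rewrite !inE ?eqxx // negb_or => /andP[_ vD].
by apply: leq_ltn_trans (critD v vS vD); apply: anti; apply/setUS/subsetUr.
Qed.

Definition max_colourable_without (G : sgraph) t (D : {set G}) : nat :=
  max_colourable (@unrestricted G t) (~: D).

Lemma max_colourable_without_anti (G : sgraph) t :
  {homo @max_colourable_without G t : A B / A \subset B >-> B <= A}.
Proof. by move=> A B AB; apply: max_colourableW => //; rewrite setCS. Qed.

Lemma critical_colourable (G : sgraph) t (D : {set G}) :
  critical (@max_colourable_without G t) setT D ->
  max_colourable_without t D = #|~: D|.
Proof.
move=> [fD critD].
have [c cP cE] := max_colourable_attained (@unrestricted G t) (~: D).
apply/eqP; rewrite eqn_leq max_colourable_leq_card /max_colourable_without -cE.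
apply/subset_leq_card/subsetP => u; rewrite inE => uD; apply: contraT => cu.
have := critD u (in_setT u) uD; rewrite ltnNge -fD => /negP[].
rewrite /max_colourable_without -cE.
apply/leq_max_colourable/list_colouringP => v j cv.
have [vD vj nbr] := list_colouringP _ _ _ cP v j cv; split=> //.
move: vD; rewrite !inE negb_or => ->; rewrite andbT.
by apply: contraNneq cu => <-; rewrite inE cv.
Qed.

Lemma min_clique_deletion_set_critical (G : sgraph) t (D : {set G}) :
  chordal G -> critical (@max_colourable_without G t) setT D ->
  min_clique_deletion_set t.+1 D.
Proof.
move=> chG critD; have [fD _] := critD; have colD := critical_colourable critD.
split; first exact/clique_deletion_set_colourable.
move=> W /(clique_deletion_set_colourable _ _ chG) colW.
have : #|~: W| <= #|~: D|.
  by rewrite -colW -colD fD; apply/max_colourable_without_anti/sub0set.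
by have := cardsC D; have := cardsC W; lia.
Qed.

(** * Simplicial elimination *)

Section Elimination.

Variable G : sgraph.

Implicit Types (A B D : {set G}) (rt : G -> G).

(* [A] is the set of the remaining vertices. The eliminated ones are grouped
   into blocks, [rt] sending each of them to the last eliminated vertex of its
   block; a block sees the remaining graph only through the clique of the
   neighbours of its root. *)
Record elimination A rt : Prop := Elimination {
  elim_root_out : forall u, u \notin A -> rt u \notin A;
  elim_root_root : forall u, u \notin A -> rt (rt u) = rt u;
  elim_simplicial : forall u, u \notin A -> simplicial A (rt u);
  elim_nbr_in : forall u v, u \notin A -> v \in A -> adj u v -> adj (rt u) v;
  elim_nbr_out : forall u v, u \notin A -> v \notin A -> adj u v -> rt u = rt v
}.

Definition block A rt w : {set G} := [set u in ~: A | rt u == w].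

Definition block_roots A rt : {set G} := [set w in ~: A | rt w == w].

Definition reroot A rt v : G -> G :=
  fun u => if (u == v) || (u \notin A) && adj (rt u) v then v else rt u.

Lemma eliminationT rt : elimination setT rt.
Proof. by split=> u; rewrite in_setT. Qed.

Lemma notin_block A rt w : elimination A rt -> w \notin block_roots A rt ->
  block A rt w = set0.
Proof.
move=> elimA wR; apply/setP => u; rewrite !inE; apply/negP => /andP[uA /eqP uw].
by rewrite !inE -uw (elim_root_out elimA) // (elim_root_root elimA) ?eqxx in wR.
Qed.

Lemma elimination_step A rt v : elimination A rt -> v \in A -> simplicial A v ->
  elimination (A :\ v) (reroot A rt v).
Proof.
move=> elimA vA simpv; have [root_out root_root simp nbr_in nbr_out] := elimA.
have out u : u \notin A :\ v -> u = v \/ u != v /\ u \notin A.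
  by rewrite !inE; case: eqVneq => [->|uv] /=; [left | right].
have rerootv : reroot A rt v v = v by rewrite /reroot eqxx.
have vrt u : u \notin A -> (rt u == v) = false.
  by move=> uA; apply: contraNF (root_out u uA) => /eqP->.
have reroot_out u : u != v -> u \notin A ->
    reroot A rt v u = if adj (rt u) v then v else rt u.
  by move=> uv uA; rewrite /reroot (negPf uv) uA.
split.
- move=> u /out[->|[uv uA]]; first by rewrite rerootv setD11.
  rewrite reroot_out //; case: ifP; rewrite ?setD11 // => _.
  by rewrite !inE negb_and root_out ?orbT.
- move=> u /out[->|[uv uA]]; first by rewrite !rerootv.
  rewrite (reroot_out u) //; case: ifP => [_|rtv]; first exact: rerootv.
  by rewrite reroot_out ?vrt ?root_out // root_root // rtv.
- move=> u uA'; apply: simplicialW (subD1set _ _) _.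
  case/out: uA' => [->|[uv uA]]; first by rewrite rerootv.
  by rewrite reroot_out //; case: ifP => _ //; apply: simp.
- move=> u w /out[->|[uv uA]]; rewrite ?rerootv // !inE => /andP[wv wA] uw.
  rewrite reroot_out //; case: ifP => [rtv|_]; last exact: nbr_in.
  by apply: (simp u uA); rewrite ?inE ?vA ?rtv ?wA ?nbr_in // eq_sym.
- have merge u : u != v -> u \notin A -> adj u v -> reroot A rt v u = v.
    by move=> uv uA uv_adj; rewrite reroot_out // nbr_in.
  move=> u w /out[->|[uv uA]] /out[->|[wv wA]] uw //; rewrite ?rerootv.
  + by rewrite (merge w) // adj_sym.
  + by rewrite (merge u).
  + by rewrite !reroot_out // (nbr_out u w).
Qed.

Lemma block_roots_reroot A rt v :
  block_roots (A :\ v) (reroot A rt v) =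
  v |: [set w in block_roots A rt | ~~ adj w v].
Proof.
apply/setP => w; rewrite !inE /reroot.
case: (eqVneq w v) => [->|wv] /=; first by rewrite eqxx.
case: (boolP (w \in A)) => //= wA.
have vw : (v == w) = false by rewrite eq_sym; apply: negPf.
have [rtw|rtw] := eqVneq (rt w) w; last by case: ifP; rewrite ?vw ?(negPf rtw).
by rewrite rtw; case: ifP; rewrite ?vw ?eqxx.
Qed.

Lemma block_reroot_new A rt v : elimination A rt -> v \in A ->
  block (A :\ v) (reroot A rt v) v = v |: [set u in ~: A | adj (rt u) v].
Proof.
move=> elimA vA; apply/setP => u; rewrite !inE /reroot.
case: (eqVneq u v) => [->|uv] /=; first by rewrite eqxx.
case: (boolP (u \in A)) => //= uA; case: ifP => _; first by rewrite eqxx.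
by apply: contraNF (elim_root_out elimA uA) => /eqP->.
Qed.

Lemma block_reroot_old A rt v w :
  v \in A -> w \in block_roots A rt -> ~~ adj w v ->
  block (A :\ v) (reroot A rt v) w = block A rt w.
Proof.
rewrite !inE => vA /andP[wA _] wv.
have vw : (v == w) = false by apply: contraNF wA => /eqP<-.
apply/setP => u; rewrite !inE /reroot.
case: (eqVneq u v) => [->|uv] /=; first by rewrite vA vw.
case: (boolP (u \in A)) => //= uA; case: ifP => // rtv.
by rewrite vw; apply/esym; apply: contraNF wv => /eqP<-.
Qed.

Lemma max_colourable_blocks t (L : G -> pred 'I_t) A rt D (P : pred G) :
  elimination A rt ->
  max_colourable L ([set u in ~: A | P (rt u)] :\: D) =
  \sum_(w in block_roots A rt | P w) max_colourable L (block A rt w :\: D).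
Proof.
move=> elimA; rewrite (max_colourable_partition (f := rt)); last first.
  move=> u v; rewrite !inE => /and3P[_ uA _] /and3P[_ vA _].
  exact: (elim_nbr_out elimA).
have empty i : (forall u, u \notin A -> rt u = i -> ~~ P i) ->
    [set u in [set u in ~: A | P (rt u)] :\: D | rt u == i] = set0.
  move=> noP; apply/setP => u; rewrite !inE; apply/negP.
  move=> /andP[/and3P[_ uA Pu] /eqP ui].
  by move: Pu; rewrite ui; apply/negP/(noP u).
rewrite [RHS]big_mkcond; apply: eq_bigr => w _.
have [wR|wR] := boolP (w \in block_roots A rt); last first.
  rewrite empty ?max_colourable0 // => u uA uw.
  by have := in_set0 u; rewrite -(notin_block elimA wR) !inE uA uw eqxx.
have [Pw|Pw] := boolP (P w); last by rewrite empty ?max_colourable0.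
congr max_colourable; apply/setP => u; rewrite !inE.
by case: eqP => [->|]; rewrite ?Pw ?andbT ?andbF.
Qed.

(* [x j] is the vertex of colour [j] outside the block to be coloured, or an
   isolated vertex if there is none. *)
Definition boundary t (x : 'I_t -> G) : G -> pred 'I_t :=
  fun u j => ~~ adj (x j) u.

Definition remaining_or_isolated A y : bool :=
  (y \in A) || [forall u, ~~ adj y u].

Lemma remaining_or_isolatedW A B y :
  A \subset B -> remaining_or_isolated A y -> remaining_or_isolated B y.
Proof. by move=> AB /orP[/(subsetP AB) yB|iso]; apply/orP; [left|right]. Qed.

Lemma max_colourable_new_block t (x : 'I_t -> G) A rt D v :
  elimination A rt -> v \in A ->
  (forall j, remaining_or_isolated (A :\ v) (x j)) ->
  let old_blocks x := \sum_(w in block_roots A rt | adj w v)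
    max_colourable (boundary x) (block A rt w :\: D) in
  max_colourable (boundary x) (block (A :\ v) (reroot A rt v) v :\: D) =
  maxn (old_blocks x) (\max_(j < t | (v \notin D) && ~~ adj (x j) v)
    (old_blocks (fun i => if i == j then v else x i)).+1).
Proof.
move=> elimA vA xA old_blocks; rewrite (block_reroot_new elimA) // setDUl.
pose U := [set u in ~: A | adj (rt u) v] :\: D; rewrite -/U.
have oldE y : old_blocks y = max_colourable (boundary y) U.
  exact/esym/(max_colourable_blocks _ _ (fun w => adj w v) elimA).
case: (boolP (v \in D)) => [vD|vD] /=.
  rewrite (_ : [set v] :\: D = set0) ?set0U ?big_pred0_eq ?maxn0 ?oldE //.
  by apply/eqP; rewrite setD_eq0 sub1set.
rewrite (_ : [set v] :\: D = [set v]); last first.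
  by apply/setDidPl; rewrite disjoints1.
rewrite max_colourable_setU1 ?oldE; last by rewrite !inE vA andbF.
congr maxn; apply: eq_bigr => j xjv; rewrite oldE; congr _.+1.
apply: eq_max_colourable => u; rewrite !inE => /and3P[_ uA rtuv] i.
rewrite /forbid /boundary; case: eqP => [->|_]; last by rewrite andbT.
suff -> : adj (x j) u = false by [].
apply/negP => xju; case/orP: (xA j) => [|/forallP/(_ u)]; last by rewrite xju.
rewrite !inE => /andP[xv xjA]; case/negP: xjv.
apply: (elim_simplicial elimA uA) xv; rewrite ?inE ?vA ?rtuv ?xjA //.
by apply: (elim_nbr_in elimA); rewrite 1?adj_sym.
Qed.

End Elimination.

(** * Straight-line code, conditionals and loops *)

Definition reaches (P : program) (B : nat) (c c' : config) : Prop :=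
  exists2 t, t <= B & iter t (step P) c = c'.

Lemma reaches_refl P B c : reaches P B c c.
Proof. by exists 0. Qed.

Lemma reaches_trans P B1 B2 c1 c2 c3 :
  reaches P B1 c1 c2 -> reaches P B2 c2 c3 -> reaches P (B1 + B2) c1 c3.
Proof.
move=> [t1 t1B <-] [t2 t2B <-]; exists (t2 + t1); last exact: iterD.
by rewrite addnC leq_add.
Qed.

Lemma reachesW P B B' c c' : B <= B' -> reaches P B c c' -> reaches P B' c c'.
Proof. by move=> leB [t tB tE]; exists t => //; apply: leq_trans leB. Qed.

Lemma reaches_step P B l r inp o c a :
  onth P l = Some a -> reaches P B (exec (Config l r inp o) a) c ->
  reaches P B.+1 (Config l r inp o) c.
Proof.
by move=> atl [t tB tE]; exists t.+1 => //; rewrite iterSr /step atl.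
Qed.

Definition code_at (P : program) (l : nat) (code : seq instr) : Prop :=
  forall i a, onth code i = Some a -> onth P (l + i) = Some a.

Lemma code_at_cat P l c1 c2 :
  code_at P l (c1 ++ c2) -> code_at P l c1 /\ code_at P (l + size c1) c2.
Proof.
move=> atcode; split=> i a ai; last first.
  by rewrite -addnA; apply: atcode; rewrite onth_cat ltnNge leq_addr addKn.
by apply: atcode; rewrite onth_cat -onthTE ai.
Qed.

Lemma code_at_cons P l a code :
  code_at P l (a :: code) -> onth P l = Some a /\ code_at P l.+1 code.
Proof.
move=> atcode; split; first by rewrite -[l]addn0; apply: atcode.
by move=> i b bi; rewrite addSnnS; apply: atcode.
Qed.

(* Started at [l] with registers [r] and output [o], [code] runs to its end in
   at most [B] steps, without reading input, and establishes [Q]. *)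
Definition triple (P : program) (inp : seq bool) (l : nat) (code : seq instr)
    (B : nat) (r : nat -> nat) (o : seq bool)
    (Q : (nat -> nat) -> seq bool -> Prop) : Prop :=
  code_at P l code -> exists r' o',
    reaches P B (Config l r inp o) (Config (l + size code) r' inp o') /\
    Q r' o'.

Section Triples.

Variables (P : program) (inp : seq bool).

Local Notation triple := (triple P inp).

Implicit Types (r : nat -> nat) (o : seq bool) (l d k : nat).
Implicit Types (cc code : seq instr).
Implicit Types (Q : (nat -> nat) -> seq bool -> Prop).

Lemma tripleW l code B r o Q Q' : (forall r' o', Q r' o' -> Q' r' o') ->
  triple l code B r o Q -> triple l code B r o Q'.
Proof.
move=> QQ' codeP /codeP[r' [o' [reach Qr']]]; exists r', o'.
by split=> //; apply: QQ'.
Qed.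

Lemma triple_cat l code1 code2 B1 B2 r o Q1 Q :
  triple l code1 B1 r o Q1 ->
  (forall r' o', Q1 r' o' -> triple (l + size code1) code2 B2 r' o' Q) ->
  triple l (code1 ++ code2) (B1 + B2) r o Q.
Proof.
move=> code1P code2P /code_at_cat[/code1P[r1 [o1 [reach1 Q1r1]]]].
move=> /(code2P _ _ Q1r1)[r2 [o2 [reach2 Qr2]]].
exists r2, o2; split=> //; rewrite size_cat addnA.
exact: reaches_trans reach1 reach2.
Qed.

Definition straight (a : instr) : bool :=
  match a with
  | IConst _ _ | IAdd _ _ _ | ISub _ _ _ | IGet _ _ | IPut _ _ => true
  | _ => false
  end.

Definition effect r (a : instr) : nat -> nat :=
  reg (exec (Config 0 r [::] [::]) a).

Lemma reaches_straight l code r o : all straight code -> code_at P l code ->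
  reaches P (size code) (Config l r inp o)
    (Config (l + size code) (foldl effect r code) inp o).
Proof.
elim: code l r => [|a code IH] l r /=; first by rewrite addn0; exists 0.
move=> /andP[sa scode] /code_at_cons[ata atcode]; apply: reaches_step ata _.
have -> : exec (Config l r inp o) a = Config l.+1 (effect r a) inp o.
  by case: a sa.
by rewrite -addSnnS; apply: IH.
Qed.

Lemma triple_straight l code r o Q : all straight code ->
  Q (foldl effect r code) o -> triple l code (size code) r o Q.
Proof.
move=> scode Qr atcode; exists (foldl effect r code), o; split=> //.
exact: reaches_straight.
Qed.

(* Evaluates [cc] to register [2 d], then runs [ca] or [cb]; the code of both
   branches depends on the address where it is placed. *)
Definition if_code d l cc (ca cb : nat -> seq instr) : seq instr :=
  let l1 := l + size cc in
  let b := cb l1.+1 in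
  let l2 := l1 + (size b).+3 in
  let a := ca l2 in
  cc ++ IJump l2 d.*2 :: b ++
  [:: IConst d.+1.*2 1; IJump (l2 + size a) d.+1.*2] ++ a.

Lemma triple_if d l cc ca cb Bc Ba Bb r o Qc Q :
  triple l cc Bc r o Qc ->
  (forall l' r' o', Qc r' o' -> 0 < r' d.*2 -> triple l' (ca l') Ba r' o' Q) ->
  (forall l' r' o', Qc r' o' -> r' d.*2 = 0 -> triple l' (cb l') Bb r' o'
    (fun r'' o'' => Q (set_reg r'' d.+1.*2 1) o'')) ->
  triple l (if_code d l cc ca cb) (Bc + (Ba + Bb + 3)) r o Q.
Proof.
move=> ccP caP cbP; rewrite /if_code; set l1 := l + size cc; set b := cb l1.+1.
set l2 := l1 + (size b).+3; set a := ca l2.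
apply: triple_cat ccP _ => r1 o1 Qr1 /code_at_cons[jump].
move=> /code_at_cat[atb] /(@code_at_cat _ _ [:: _; _])[atskip ata].
rewrite -/l1 in jump atb atskip ata *.
have ata' : code_at P l2 a by move: ata; rewrite /l2 addn2 !addnS.
have -> : l1 + size (IJump l2 d.*2 :: b ++ [:: IConst d.+1.*2 1;
    IJump (l2 + size a) d.+1.*2] ++ a) = l2 + size a.
  by rewrite /l2 /= size_cat /=; lia.
rewrite addn3; case: (posnP (r1 d.*2)) => r1d.
  have [r2 [o2 [reach Q2]]] := cbP _ _ _ Qr1 r1d atb.
  exists (set_reg r2 d.+1.*2 1), o2; split=> //.
  apply: reaches_step jump _; rewrite /= r1d /=.
  apply: reachesW (reaches_trans reach _); last first.
    have [const /code_at_cons[skip _]] := code_at_cons atskip.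
    apply: reaches_step const _; apply: reaches_step skip _.
    by rewrite /= {1}/set_reg eqxx; apply: (reaches_refl _ 0).
  by lia.
have [r2 [o2 [reach Q2]]] := caP _ _ _ Qr1 r1d ata'; exists r2, o2; split=> //.
by apply: reaches_step jump _; rewrite /= r1d; apply: reachesW reach; lia.
Qed.

Definition low_eq d r r' : Prop := forall i, i < d -> r' i.*2 = r i.*2.

Definition frame d r r' : Prop :=
  low_eq d r r' /\ forall a, r' a.*2.+1 = r a.*2.+1.

Lemma frame_refl d r : frame d r r.
Proof. by []. Qed.

Lemma low_eq_trans d d' r1 r2 r3 :
  d <= d' -> low_eq d r1 r2 -> low_eq d' r2 r3 -> low_eq d r1 r3.
Proof.
by move=> led eq12 eq23 i ltid; rewrite eq23 ?eq12 //; apply: leq_trans led.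
Qed.

Lemma frame_trans d d' r1 r2 r3 :
  d <= d' -> frame d r1 r2 -> frame d' r2 r3 -> frame d r1 r3.
Proof.
move=> led [low12 heap12] [low23 heap23]; split=> [|a]; last by rewrite heap23.
exact: low_eq_trans low23.
Qed.

Lemma set_regE r i v : set_reg r i v i = v.
Proof. by rewrite /set_reg eqxx. Qed.

Lemma set_reg_neq r i j v : j != i -> set_reg r i v j = r j.
Proof. by rewrite /set_reg => /negPf->. Qed.

Lemma frame_set d k r r' v :
  d <= k -> frame d r r' -> frame d r (set_reg r' k.*2 v).
Proof.
by move=> ledk [low heap]; split=> [i ltid|a];
  rewrite set_reg_neq ?low ?heap //; lia.
Qed.

Section Loop.

Variables (N k l : nat) (body : seq instr).

Definition loop_tick : seq instr :=
  [:: IConst k.+1.*2 1; IAdd k.*2 k.*2 k.+1.*2; ISub k.+1.*2 0 k.*2].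

(* The test comes last: the body is run at least once. *)
Definition loop_code : seq instr :=
  IConst k.*2 0 :: body ++ loop_tick ++ [:: IJump l.+1 k.+1.*2].

Hypotheses (N_gt0 : 0 < N) (k_gt0 : 0 < k).

Lemma effect_loop_tick r y : r 0 = N -> r k.*2 = y ->
  let r' := foldl effect r loop_tick in
  [/\ frame k r r', r' k.*2 = y.+1 & r' k.+1.*2 = N - y.+1].
Proof.
move=> r0 rk r'; pose r1 := set_reg r k.+1.*2 1.
pose r2 := set_reg r1 k.*2 (r1 k.*2 + r1 k.+1.*2).
have -> : r' = set_reg r2 k.+1.*2 (r2 0 - r2 k.*2) by [].
have r2k : r2 k.*2 = y.+1.
  by rewrite /r2 /r1 !set_regE set_reg_neq ?rk ?addn1 //; lia.
split; first by do 3![apply: frame_set => //]; apply: frame_refl.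
  by rewrite set_reg_neq //; lia.
by rewrite set_regE r2k /r2 /r1 !set_reg_neq ?r0 //; lia.
Qed.

Variables (B : nat) (J : nat -> (nat -> nat) -> seq bool -> Prop).
Hypothesis J_frame : forall y r r' o, J y r o -> frame k r r' -> J y r' o.
Hypothesis J_size : forall y r o, J y r o -> r 0 = N.
Hypothesis bodyP : forall y r o, y < N -> J y r o -> r k.*2 = y ->
  triple l.+1 body B r o (fun r' o' => J y.+1 r' o' /\ r' k.*2 = y).

Lemma loop_turn y r o : code_at P l loop_code ->
  y < N -> J y r o -> r k.*2 = y -> exists r' o',
  [/\ reaches P (B + 4) (Config l.+1 r inp o)
        (Config (if y.+1 < N then l.+1 else l + size loop_code) r' inp o'),
      J y.+1 r' o' & r' k.*2 = y.+1].
Proof.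
move=> /code_at_cons[_ /code_at_cat[atbody /code_at_cat[attick]]].
move=> /code_at_cons[jump _] ltyN Jy ry.
have [r1 [o1 [reach [Jy1 r1y]]]] := bodyP ltyN Jy ry atbody.
have [fr tick_y tick_test] := effect_loop_tick (J_size Jy1) r1y.
exists (foldl effect r1 loop_tick), o1; split=> //; last exact: J_frame fr.
apply: reaches_trans reach (reaches_trans (reaches_straight r1 o1 _ attick) _).
  by [].
move: (foldl effect r1 _) tick_test => r2 tick_test.
have -> : l + size loop_code = (l.+1 + size body + size loop_tick).+1.
  by rewrite /loop_code /= size_cat /=; lia.
apply: reaches_step jump _; rewrite /= tick_test subn_gt0.
exact: reaches_refl.
Qed.

Lemma triple_loop r o :
  J 0 r o -> triple l loop_code (1 + N * (B + 4)) r o (J N).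
Proof.
move=> J0 atloop; have [start _] := code_at_cons atloop.
have iterate m y r1 o1 : y + m.+1 = N -> J y r1 o1 -> r1 k.*2 = y ->
    exists r' o', reaches P (m.+1 * (B + 4)) (Config l.+1 r1 inp o1)
      (Config (l + size loop_code) r' inp o') /\ J N r' o'.
  elim: m y r1 o1 => [|m IH] y r1 o1 yN Jy r1y.
    have [|r2 [o2 [reach Jy1 _]]] := loop_turn atloop _ Jy r1y; first by lia.
    by exists r2, o2; move: reach Jy1; rewrite mul1n -yN addn1 ltnn.
  have [|r2 [o2 [reach Jy1 r2y]]] := loop_turn atloop _ Jy r1y; first by lia.
  have [|r3 [o3 [reach' JN]]] := IH y.+1 r2 o2 _ Jy1 r2y; first by lia.
  exists r3, o3; split=> //; rewrite mulSn; apply: reaches_trans reach _.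
  by rewrite ifT //; lia.
have [|||r1 [o1 [reach JN]]] := iterate N.-1 0 (set_reg r k.*2 0) o.
- by lia.
- exact: J_frame J0 (frame_set _ (leqnn k) (frame_refl k r)).
- exact: set_regE.
exists r1, o1; split=> //; apply: reaches_step start _.
by rewrite -(prednK N_gt0).
Qed.

End Loop.

End Triples.

(** * A structured language and its compilation *)

Inductive expr :=
  | EConst of nat
  | EVar of nat
  | EAdd of expr & expr
  | ESub of expr & expr
  | ELoad of expr
  | EIf of expr & expr & expr
  | ESum of nat & expr.

Fixpoint eval (N : nat) (h env : nat -> nat) (e : expr) : nat :=
  match e with
  | EConst v => v
  | EVar i => env i
  | EAdd a b => eval N h env a + eval N h env b
  | ESub a b => eval N h env a - eval N h env b
  | ELoad a => h (eval N h env a)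
  | EIf c a b => if 0 < eval N h env c then eval N h env a else eval N h env b
  | ESum i a => \sum_(y < N) eval N h (set_reg env i y) a
  end.

Inductive cmd :=
  | CPut of expr & expr
  | CSeq of cmd & cmd
  | CIf of expr & cmd
  | CFor of nat & cmd
  | CLet of nat & expr & cmd
  | CPrint of expr.

Definition state := ((nat -> nat) * seq bool)%type.

(* Variables have static scope; a state consists of the heap and the output. *)
Fixpoint run (N : nat) (env : nat -> nat) (c : cmd) (s : state) : state :=
  match c with
  | CPut a e => (set_reg s.1 (eval N s.1 env a) (eval N s.1 env e), s.2)
  | CSeq c1 c2 => run N env c2 (run N env c1 s)
  | CIf e c => if 0 < eval N s.1 env e then run N env c s else s
  | CFor i c => iteri N (fun y => run N (set_reg env i y) c) s
  | CLet i e c => run N (set_reg env i (eval N s.1 env e)) c s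
  | CPrint e => (s.1, rcons s.2 (0 < eval N s.1 env e))
  end.

(* Register 0 holds [N]; the other even registers form the evaluation stack, [d]
   being the depth of its first free cell and [rho i] that of variable [i];
   heap cell [a] is register [2 a + 1]. *)

Definition heap_addr (d e : nat) : seq instr :=
  [:: IAdd d.*2 d.*2 d.*2; IConst e.*2 1; IAdd d.*2 d.*2 e.*2].

Fixpoint ecode (rho : nat -> nat) (d l : nat) (e : expr) : seq instr :=
  match e with
  | EConst v => [:: IConst d.*2 v]
  | EVar i => [:: IConst d.*2 0; IAdd d.*2 d.*2 (rho i).*2]
  | EAdd a b =>
      let ca := ecode rho d l a in
      ca ++ ecode rho d.+1 (l + size ca) b ++ [:: IAdd d.*2 d.*2 d.+1.*2]
  | ESub a b =>
      let ca := ecode rho d l a in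
      ca ++ ecode rho d.+1 (l + size ca) b ++ [:: ISub d.*2 d.*2 d.+1.*2]
  | ELoad a => ecode rho d l a ++ heap_addr d d.+1 ++ [:: IGet d.*2 d.*2]
  | EIf c a b =>
      if_code d l (ecode rho d l c) (fun l => ecode rho d l a)
        (fun l => ecode rho d l b)
  | ESum i a =>
      IConst d.*2 0 :: loop_code d.+1 l.+1
        (ecode (set_reg rho i d.+1) d.+2 l.+2 a ++ [:: IAdd d.*2 d.*2 d.+2.*2])
  end.

Fixpoint ecost (N : nat) (e : expr) : nat :=
  match e with
  | EConst _ => 1
  | EVar _ => 2
  | EAdd a b | ESub a b => ecost N a + (ecost N b + 1)
  | ELoad a => ecost N a + 4
  | EIf c a b => ecost N c + (ecost N a + ecost N b + 3)
  | ESum _ a => 1 + (1 + N * (ecost N a + 1 + 4))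
  end.

Fixpoint ccode (rho : nat -> nat) (d l : nat) (c : cmd) : seq instr :=
  match c with
  | CPut a e =>
      let ca := ecode rho d l a in
      ca ++ ecode rho d.+1 (l + size ca) e ++ heap_addr d d.+2 ++
      [:: IPut d.*2 d.+1.*2]
  | CSeq c1 c2 =>
      let k := ccode rho d l c1 in k ++ ccode rho d (l + size k) c2
  | CIf e c =>
      if_code d l (ecode rho d l e) (fun l => ccode rho d l c) (fun=> [::])
  | CFor i c => loop_code d l (ccode (set_reg rho i d) d.+1 l.+1 c)
  | CLet i e c =>
      let k := ecode rho d l e in
      k ++ ccode (set_reg rho i d) d.+1 (l + size k) c
  | CPrint e => ecode rho d l e ++ [:: IPrint d.*2]
  end.

Fixpoint ccost (N : nat) (c : cmd) : nat :=
  match c with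
  | CPut a e => ecost N a + (ecost N e + 4)
  | CSeq c1 c2 => ccost N c1 + ccost N c2
  | CIf e c => ecost N e + (ccost N c + 0 + 3)
  | CFor _ c => 1 + N * (ccost N c + 4)
  | CLet _ e c => ecost N e + ccost N c
  | CPrint e => ecost N e + 1
  end.

Definition holds_heap (h r : nat -> nat) : Prop := forall a, r a.*2.+1 = h a.

Record models (N : nat) (h env rho : nat -> nat) (d : nat) (r : nat -> nat) :
    Prop := Models {
  models_size : r 0 = N;
  models_depth : 0 < d;
  models_scope : forall i, rho i < d;
  models_var : forall i, r (rho i).*2 = env i;
  models_heap : holds_heap h r
}.

Section Compiler.

Variables (P : program) (inp : seq bool) (N : nat).
Hypothesis N_gt0 : 0 < N.

Local Notation triple := (triple P inp).

Implicit Types (h env rho r : nat -> nat) (o : seq bool) (d l : nat).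

Lemma models_low h h' env rho d r r' : models N h env rho d r ->
  low_eq d r r' -> holds_heap h' r' -> models N h' env rho d r'.
Proof.
move=> [r0 d_gt0 scope var _] low heap.
by split=> // [|i]; [rewrite (low 0) | rewrite low].
Qed.

Lemma models_frame h env rho d r r' :
  models N h env rho d r -> frame d r r' -> models N h env rho d r'.
Proof.
move=> mod [low heap]; apply: (models_low mod low) => a.
by rewrite heap (models_heap mod).
Qed.

Lemma models_deeper h env rho d d' r :
  d <= d' -> models N h env rho d r -> models N h env rho d' r.
Proof.
move=> led [? d_gt0 scope ? ?]; split=> // [|i]; first exact: leq_trans led.
exact: leq_trans (scope i) led.
Qed.

Lemma models_bind h env rho d r i : models N h env rho d r ->
  models N h (set_reg env i (r d.*2)) (set_reg rho i d) d.+1 r.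
Proof.
move=> [? ? scope var ?]; split=> // j; rewrite /set_reg; case: eqP => // _.
exact: leqW.
Qed.

(* [e], compiled at depth [d], leaves its value in register [2 d]. *)
Definition expr_correct (e : expr) : Prop := forall h env rho d l r o,
  models N h env rho d r -> triple l (ecode rho d l e) (ecost N e) r o
    (fun r' o' => [/\ o' = o, r' d.*2 = eval N h env e & frame d r r']).

Lemma ecode_const v : expr_correct (EConst v).
Proof.
move=> h env rho d l r o mod; apply: triple_straight => //.
split=> //; first exact: set_regE.
exact: frame_set (leqnn d) (frame_refl d _).
Qed.

Lemma ecode_var i : expr_correct (EVar i).
Proof.
move=> h env rho d l r o mod; apply: triple_straight => //=.
rewrite /effect /=; split=> //.
  rewrite !set_regE set_reg_neq ?(models_var mod) //.
  by have := models_scope mod i; lia.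
by do 2![apply: frame_set => //].
Qed.

Lemma ecode_binary (e a b : expr) (I : nat -> nat -> nat -> instr)
    (op : nat -> nat -> nat) :
  (forall r i j k, straight (I i j k) /\
     effect r (I i j k) = set_reg r i (op (r j) (r k))) ->
  (forall h env, eval N h env e = op (eval N h env a) (eval N h env b)) ->
  (forall rho d l, ecode rho d l e = let ca := ecode rho d l a in
     ca ++ ecode rho d.+1 (l + size ca) b ++ [:: I d.*2 d.*2 d.+1.*2]) ->
  ecost N e = ecost N a + (ecost N b + 1) ->
  expr_correct a -> expr_correct b -> expr_correct e.
Proof.
move=> IE evalE codeE costE IHa IHb h env rho d l r o mod; rewrite codeE costE.
apply: triple_cat (IHa _ _ _ _ _ _ _ mod) _ => r1 o1 [-> r1d fr1].
have mod1 := models_deeper (leqnSn d) (models_frame mod fr1).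
apply: triple_cat (IHb _ _ _ _ _ _ _ mod1) _ => r2 o2 [-> r2d [low2 heap2]].
have [straightI effectI] := IE r2 d.*2 d.*2 d.+1.*2.
apply: triple_straight; first by rewrite /= straightI.
rewrite [foldl _ _ _]/= effectI set_regE r2d low2 // r1d evalE; split=> //.
exact: frame_set (leqnn d) (frame_trans (leqnSn d) fr1 (conj low2 heap2)).
Qed.

Lemma effect_heap_addr d e r : d < e ->
  let r' := foldl effect r (heap_addr d e) in
  [/\ r' d.*2 = (r d.*2).*2.+1, frame d r r' &
      forall x, x != d -> x != e -> r' x.*2 = r x.*2].
Proof.
move=> ltde; split=> /=.
- rewrite /effect /= !set_regE set_reg_neq ?set_regE ?addnn ?addn1 //; lia.
- by rewrite /effect /=; do 3![apply: frame_set; try lia].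
- by move=> x xd xe; rewrite /effect /= !set_reg_neq //; lia.
Qed.

Lemma ecode_load a : expr_correct a -> expr_correct (ELoad a).
Proof.
move=> IHa h env rho d l r o mod.
apply: triple_cat (IHa _ _ _ _ _ _ _ mod) _ => r1 o1 [-> r1d fr1].
apply: (@triple_straight _ _ _ (heap_addr d d.+1 ++ [:: IGet d.*2 d.*2])) => //.
rewrite foldl_cat; set r2 := foldl effect r1 _.
have [r2d fr2 _] := effect_heap_addr r1 (ltnSn d); rewrite -/r2 in r2d fr2.
rewrite [foldl _ _ _]/= /effect /= set_regE; split=> //.
  by rewrite r2d (models_heap (models_frame (models_frame mod fr1) fr2)) r1d.
exact: frame_set (leqnn d) (frame_trans (leqnn d) fr1 fr2).
Qed.

Lemma ecode_if c a b :
  expr_correct c -> expr_correct a -> expr_correct b ->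
  expr_correct (EIf c a b).
Proof.
move=> IHc IHa IHb h env rho d l r o mod.
apply: triple_if (IHc _ _ _ _ _ _ _ mod) _ _ => l1 r1 o1.
- move=> [-> r1d fr1]; rewrite r1d => c_gt0.
  apply: tripleW _ (IHa _ _ _ _ _ _ _ (models_frame mod fr1)) => r2 o2.
  move=> [-> r2d fr2]; rewrite /= c_gt0; split=> //.
  exact: frame_trans fr1 fr2.
- move=> [-> r1d fr1]; rewrite r1d => c0.
  apply: tripleW _ (IHb _ _ _ _ _ _ _ (models_frame mod fr1)) => r2 o2.
  move=> [-> r2d fr2]; rewrite /= c0 set_reg_neq; last by lia.
  by split=> //; apply: frame_set (leqnSn d) (frame_trans (leqnn d) fr1 fr2).
Qed.

Lemma ecode_sum i a : expr_correct a -> expr_correct (ESum i a).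
Proof.
move=> IHa h env rho d l r o mod; have d_gt0 := models_depth mod.
pose partial y r' o' :=
  [/\ o' = o, r' d.*2 = \sum_(z < y) eval N h (set_reg env i z) a &
      frame d r r'].
apply: (@triple_cat _ _ l [:: IConst d.*2 0] _ 1 _ r o (partial 0)).
  apply: triple_straight => //; split=> //.
    by rewrite big_ord0; apply: set_regE.
  exact: frame_set (leqnn d) (frame_refl d _).
move=> r0 o0 partial0; rewrite [l + _]addn1.
apply: (triple_loop N_gt0 (ltn0Sn d) (J := partial)) => //.
- move=> y r1 r2 o1 [-> r1d fr1] fr2; split=> //; first by rewrite fr2.1.
  exact: frame_trans fr1 fr2.
- by move=> y r1 o1 [_ _ fr1]; rewrite -(models_size mod); apply: (fr1.1 0).
- move=> y r1 o1 ltyN [-> r1d fr1] r1y.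
  have mod1 := models_bind i (models_deeper (leqnSn d) (models_frame mod fr1)).
  apply: triple_cat (IHa _ _ _ _ _ _ _ mod1) _ => r2 o2 [-> r2d [low2 heap2]].
  apply: triple_straight => //=; rewrite /effect /=; split; last first.
    by rewrite set_reg_neq ?low2 //; lia.
  split=> //; first by rewrite set_regE r2d r1y low2 // r1d big_ord_recr.
  by apply: frame_set (leqnn d) (frame_trans _ fr1 (conj low2 heap2)); lia.
Qed.

Lemma ecode_correct e : expr_correct e.
Proof.
elim: e => [v|i|a IHa b IHb|a IHa b IHb|a IHa|c IHc a IHa b IHb|i a IHa].
- exact: ecode_const.
- exact: ecode_var.
- exact: (@ecode_binary _ a b IAdd addn).
- exact: (@ecode_binary _ a b ISub subn).
- exact: ecode_load.
- exact: ecode_if.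
- exact: ecode_sum.
Qed.

Arguments ecode_correct e {h env rho d l r o}.

Definition cmd_correct (c : cmd) : Prop := forall h env rho d l r o,
  models N h env rho d r -> triple l (ccode rho d l c) (ccost N c) r o
    (fun r' o' => let s := run N env c (h, o) in
       [/\ o' = s.2, low_eq d r r' & holds_heap s.1 r']).

Lemma ccode_put a e : cmd_correct (CPut a e).
Proof.
move=> h env rho d l r o mod.
apply: triple_cat (ecode_correct a mod) _ => r1 o1 [-> r1d fr1].
have mod1 := models_deeper (leqnSn d) (models_frame mod fr1).
apply: triple_cat (ecode_correct e mod1) _ => r2 o2 [-> r2d fr2].
apply: (@triple_straight _ _ _ (heap_addr d d.+2 ++ [:: IPut _ _])) => //.
rewrite foldl_cat; set r3 := foldl effect r2 _.
have [r3d [low3 heap3] r3E] := effect_heap_addr r2 (leqnSn d.+1).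
rewrite -/r3 in r3d low3 heap3 r3E.
rewrite [foldl _ _ _]/= /effect /= r3d fr2.1 // r1d; split=> // [j ltjd|x].
  by rewrite set_reg_neq ?low3 ?fr2.1 ?fr1.1 //; lia.
rewrite /set_reg eqSS; case: eqP => [/double_inj->|ne].
  by rewrite eqxx r3E ?r2d //; lia.
rewrite ifN ?heap3 ?fr2.2 ?fr1.2 ?(models_heap mod) //.
by apply/eqP => E; case: ne; rewrite E.
Qed.

Lemma ccode_seq c1 c2 :
  cmd_correct c1 -> cmd_correct c2 -> cmd_correct (CSeq c1 c2).
Proof.
move=> IH1 IH2 h env rho d l r o mod /=.
apply: triple_cat (IH1 _ _ _ _ _ _ _ mod) _ => r1 o1 [-> low1 heap1].
apply: tripleW _ (IH2 _ _ _ _ _ _ _ (models_low mod low1 heap1)) => r2 o2.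
rewrite -surjective_pairing => -[-> low2 heap2]; split=> //.
exact: low_eq_trans low1 low2.
Qed.

Lemma ccode_if e c : cmd_correct c -> cmd_correct (CIf e c).
Proof.
move=> IHc h env rho d l r o mod.
apply: triple_if (ecode_correct e mod) _ _ => l1 r1 o1 [-> r1d fr1].
all: have mod1 := models_frame mod fr1; rewrite r1d => test /=.
  rewrite test; apply: tripleW _ (IHc _ _ _ _ _ _ _ mod1) => r2 o2.
  by move=> [-> low2 heap2]; split=> //; apply: low_eq_trans fr1.1 low2.
rewrite test; apply: (@triple_straight _ _ _ [::]) => //.
have [low heap] := frame_set 1 (leqnSn d) fr1; split=> // x.
by rewrite heap (models_heap mod).
Qed.

Lemma ccode_for i c : cmd_correct c -> cmd_correct (CFor i c).
Proof.
move=> IHc h env rho d l r o mod; have d_gt0 := models_depth mod.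
pose turns y := iteri y (fun y => run N (set_reg env i y) c) (h, o).
apply: (triple_loop N_gt0 d_gt0 (J := fun y r' o' =>
  [/\ o' = (turns y).2, low_eq d r r' & holds_heap (turns y).1 r'])) => //.
- move=> y r1 r2 o1 [-> low1 heap1] [low2 heap2]; split=> //.
    exact: low_eq_trans low1 low2.
  by move=> x; rewrite heap2.
- by move=> y r1 o1 [_ low1 _]; rewrite -(models_size mod); apply: (low1 0).
- move=> y r1 o1 ltyN [-> low1 heap1] r1y.
  have := models_bind i (models_low mod low1 heap1); rewrite r1y => mod1.
  apply: tripleW _ (IHc _ _ _ _ _ _ _ mod1) => r2 o2.
  rewrite -surjective_pairing => -[-> low2 heap2]; split; last by rewrite low2.
  by split=> //; apply: low_eq_trans low1 low2.
- by split=> //; apply: models_heap mod.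
Qed.

Lemma ccode_let i e c : cmd_correct c -> cmd_correct (CLet i e c).
Proof.
move=> IHc h env rho d l r o mod.
apply: triple_cat (ecode_correct e mod) _ => r1 o1 [-> r1d fr1].
have := models_bind i (models_frame mod fr1); rewrite r1d => mod1.
apply: tripleW _ (IHc _ _ _ _ _ _ _ mod1) => r2 o2.
move=> [-> low2 heap2]; split=> //; exact: low_eq_trans fr1.1 low2.
Qed.

Lemma ccode_print e : cmd_correct (CPrint e).
Proof.
move=> h env rho d l r o mod.
apply: triple_cat (ecode_correct e mod) _ => r1 o1 [-> r1d fr1].
move=> /code_at_cons[print _]; exists r1, (rcons o (0 < r1 d.*2)); split.
  by rewrite addn1; apply: reaches_step print _; apply: reaches_refl.
rewrite r1d; split=> //; first exact: fr1.1.
exact: models_heap (models_frame mod fr1).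
Qed.

Lemma ccode_correct c : cmd_correct c.
Proof.
elim: c => [a e|c1 IH1 c2 IH2|e c IH|i c IH|i e c IH|e].
- exact: ccode_put.
- exact: ccode_seq.
- exact: ccode_if.
- exact: ccode_for.
- exact: ccode_let.
- exact: ccode_print.
Qed.

End Compiler.

(** * Polynomial running time *)

Definition poly_bounded (f : nat -> nat) : Prop :=
  exists c k, forall N, 0 < N -> f N <= c * N ^ k.

Lemma poly_bounded_const c : poly_bounded (fun=> c).
Proof. by exists c, 0 => N _; rewrite expn0 muln1. Qed.

Lemma poly_bounded_id : poly_bounded id.
Proof. by exists 1, 1 => N _; rewrite mul1n expn1. Qed.

Lemma poly_boundedD f g :
  poly_bounded f -> poly_bounded g -> poly_bounded (fun N => f N + g N).
Proof.
move=> [c1 [k1 fP]] [c2 [k2 gP]]; exists (c1 + c2), (k1 + k2) => N N_gt0.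
rewrite mulnDl leq_add //.
  apply: leq_trans (fP N N_gt0) _.
  by rewrite leq_mul2l leq_pexp2l ?leq_addr ?orbT.
apply: leq_trans (gP N N_gt0) _.
by rewrite leq_mul2l leq_pexp2l ?leq_addl ?orbT.
Qed.

Lemma poly_boundedM f g :
  poly_bounded f -> poly_bounded g -> poly_bounded (fun N => f N * g N).
Proof.
move=> [c1 [k1 fP]] [c2 [k2 gP]]; exists (c1 * c2), (k1 + k2) => N N_gt0.
by rewrite expnD mulnACA leq_mul ?fP ?gP.
Qed.

Lemma poly_bounded_shift f a : 0 < a -> poly_bounded f ->
  exists b k, forall m, f (m + a) <= b * m ^ k + b.
Proof.
move=> a_gt0 [c [k fP]]; exists (c * a.+1 ^ k), k => m.
apply: leq_trans (fP (m + a) _) _; first by rewrite addn_gt0 a_gt0 orbT.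
rewrite -!mulnA -[X in _ + _ * X]muln1 -!mulnDr leq_mul2l; apply/orP; right.
have expn_mono x y : x <= y -> x ^ k <= y ^ k.
  by move=> lexy; case: (k) => // j; rewrite leq_exp2r.
case: m => [|m].
  by rewrite mulnDr muln1 (leq_trans _ (leq_addl _ _)) ?expn_mono.
apply: (@leq_trans ((a.+1 * m.+1) ^ k)); first by apply: expn_mono; nia.
by rewrite expnMn leq_mul2l leq_addr orbT.
Qed.

Ltac prove_poly_bounded :=
  do ?[exact: poly_bounded_const | exact: poly_bounded_id | assumption
      | apply: poly_boundedD | apply: poly_boundedM].

Lemma ecost_poly e : poly_bounded (ecost^~ e).
Proof.
elim: e => [v|i|a IHa b IHb|a IHa b IHb|a IHa|c IHc a IHa b IHb|i a IHa] /=.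
all: by prove_poly_bounded.
Qed.

Lemma ccost_poly c : poly_bounded (ccost^~ c).
Proof.
elim: c => [a e|c1 IH1 c2 IH2|e c IH|i c IH|i e c IH|e] /=.
all: try have := ecost_poly e => ?.
all: try have := ecost_poly a => ?.
all: by prove_poly_bounded.
Qed.

(* Register 0 counts the bits read so far. Register 6 becomes positive when the
   input is exhausted, a missing bit being read as 2; otherwise it receives the
   number of the register of the next heap cell. The 4 added in the end makes
   room for the numbers of the four tables of the program below. *)
Definition read_code : seq instr :=
  [:: IRead 2; IConst 4 1; ISub 6 2 4; IJump 9 6; IAdd 6 0 0; IAdd 6 6 4;
      IPut 6 2; IAdd 0 0 4; IJump 0 4; IConst 4 4; IAdd 0 0 4].

Definition heap_of (w : seq bool) : nat -> nat := fun a => nth false w a.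

Lemma read_bit code r b inp : exists r',
  [/\ reaches (read_code ++ code) 9 (Config 0 r (b :: inp) [::])
        (Config 0 r' inp [::]),
      r' 0 = (r 0).+1 &
      forall a, r' a.*2.+1 = if a == r 0 then b : nat else r a.*2.+1].
Proof.
pose P := read_code ++ code.
pose r1 := set_reg (set_reg (set_reg r 2 b) 4 1) 6 0.
pose r2 := set_reg (set_reg r1 6 (r 0 + r 0)) 6 (r 0 + r 0 + 1).
pose r3 := set_reg r2 (r2 6) b; pose r4 := set_reg r3 0 (r3 0 + r3 4).
have r2_6 : r2 6 = (r 0).*2.+1 by rewrite /r2 set_regE addnn addn1.
have r3_low x : ~~ odd x -> r3 x = r2 x.
  move=> evenx; rewrite /r3 r2_6 set_reg_neq //.
  by apply: contraNneq evenx => ->; rewrite /= odd_double.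
exists r4; split.
- apply: (@reaches_trans _ 4 5 _ (Config 4 r1 inp [::])).
    by exists 4; rewrite // /r1; case: (b).
  apply: (@reaches_trans _ 4 1 _ (Config 8 r4 inp [::])); first by exists 4.
  exists 1 => //; rewrite /= /step /=.
  by rewrite (_ : r4 4 = 1) // /r4 set_reg_neq // r3_low.
- by rewrite /r4 set_regE !r3_low // addn1.
- move=> a; rewrite /r4 set_reg_neq // /r3 r2_6 /set_reg eqSS.
  case: eqP => [/double_inj-> |ne]; first by rewrite eqxx.
  rewrite ifN; last by apply/eqP => E; rewrite E in ne.
  by rewrite /r2 /r1 !set_reg_neq //; lia.
Qed.

Lemma read_end code r : exists r',
  [/\ reaches (read_code ++ code) 6 (Config 0 r [::] [::])
        (Config (size read_code) r' [::] [::]),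
      r' 0 = r 0 + 4 & forall a, r' a.*2.+1 = r a.*2.+1].
Proof.
eexists; split; first by exists 6.
  by rewrite /set_reg.
by move=> a; rewrite !set_reg_neq //; lia.
Qed.

Lemma read_code_correct code w : exists r,
  [/\ reaches (read_code ++ code) (9 * size w + 6) (initial w)
        (Config (size read_code) r [::] [::]),
      r 0 = size w + 4 & holds_heap (heap_of w) r].
Proof.
suff read_suffix w2 w1 r :
    r 0 = size w1 -> holds_heap (heap_of w1) r -> exists r',
    [/\ reaches (read_code ++ code) (9 * size w2 + 6) (Config 0 r w2 [::])
          (Config (size read_code) r' [::] [::]),
        r' 0 = size (w1 ++ w2) + 4 & holds_heap (heap_of (w1 ++ w2)) r'].
  by apply: (read_suffix w [::]) => // a; rewrite /heap_of nth_nil.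
elim: w2 w1 r => [|b w2 IH] w1 r r0 heap.
  have [r' [reach r'0 heap']] := read_end code r; exists r'.
  by rewrite cats0 -r0; split=> // a; rewrite heap'.
have [r1 [reach r1_0 heap1]] := read_bit code r b w2.
have [||r2 [reach2 r2_0 heap2]] := IH (rcons w1 b) r1.
- by rewrite size_rcons -r0.
- move=> a; rewrite heap1 r0 heap /heap_of nth_rcons.
  by case: ltngtP => // ltwa; rewrite nth_default // ltnW.
exists r2; rewrite -cat_rcons; split=> //.
by rewrite mulnS -addnA; apply: reaches_trans reach reach2.
Qed.

Theorem compile_correct (c : cmd) : exists P b k, forall w : seq bool,
  exists2 t, t <= b * size w ^ k + b &
    let N := size w + 4 in
    computes_in P w t (run N (fun=> N) c (heap_of w, [::])).2.
Proof.
have [//||b [k costP]] := @poly_bounded_shift (fun N => 9 * N + ccost N c) 4.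
  by have := ccost_poly c; prove_poly_bounded.
pose code := ccode (fun=> 0) 1 (size read_code) c; pose P := read_code ++ code.
exists P, b, k => w; set N := size w + 4.
have [r [reach_read r0 heap]] := read_code_correct code w.
have mod : models N (heap_of w) (fun=> N) (fun=> 0) 1 r by split.
have atcode : code_at P (size read_code) code.
  by have [] := @code_at_cat P 0 read_code code _.
have N_gt0 : 0 < N by rewrite /N addn4.
have [r' [o' [[t tB tE] [oE _ _]]]] :=
  @ccode_correct P [::] N N_gt0 c _ _ _ _ _ _ [::] mod atcode.
have [t0 t0B t0E] := reach_read.
exists (t + t0); last by rewrite /computes_in iterD t0E tE oE /P size_cat.
apply: leq_trans (costP (size w)); rewrite addnC leq_add //.
by apply: leq_trans t0B _; rewrite -/N /N; lia.
Qed.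

(** * Derived expressions *)

(* Variables bound inside derived expressions. *)
Definition digit_var := 0.
Definition factor_var := 1.
Definition bound_var := 2.

Lemma sum_const_ord N m : \sum_(y < N) m = m * N.
Proof. by rewrite sum_nat_const card_ord mulnC. Qed.

Lemma sum_ltn_ord N v m :
  v <= N -> \sum_(z < N) (if z < v then m else 0) = v * m.
Proof.
move=> levN; rewrite -big_mkcond -(big_ord_widen _ (fun=> m)) //.
by rewrite sum_nat_const card_ord.
Qed.

Definition EMul (i j : nat) : expr :=
  ESum factor_var (EIf (ESub (EVar i) (EVar factor_var)) (EVar j) (EConst 0)).

Definition ENot (a : expr) : expr := EIf a (EConst 0) (EConst 1).

Definition EAnd (a b : expr) : expr := EIf a b (EConst 0).

Definition EMaxn (a b : expr) : expr := EAdd (ESub a b) b.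

Definition ELeq (i j : nat) : expr :=
  ESub (EAdd (EVar j) (EConst 1)) (EVar i).

(* The smallest value of [i] that satisfies [a], as the number of those [z] for
   which no [i <= z] satisfies [a]. *)
Definition EFind (i : nat) (a : expr) : expr :=
  ESum bound_var (ENot (ESum i (EAnd (ELeq i bound_var) a))).

Section DerivedExpressions.

Variables (N : nat) (h env : nat -> nat).

Lemma eval_EMul i j : i != factor_var -> j != factor_var -> env i <= N ->
  eval N h env (EMul i j) = env i * env j.
Proof.
move=> iE jE leiN /=; rewrite -(sum_ltn_ord _ leiN); apply: eq_bigr => z _.
by rewrite set_regE !set_reg_neq // subn_gt0.
Qed.

Lemma eval_ENot a : eval N h env (ENot a) = ~~ (0 < eval N h env a).
Proof. by rewrite /=; case: ifP. Qed.

Lemma eval_EAnd a b :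
  (0 < eval N h env (EAnd a b)) = (0 < eval N h env a) && (0 < eval N h env b).
Proof. by rewrite /=; case: ifP. Qed.

Lemma eval_EMaxn a b :
  eval N h env (EMaxn a b) = maxn (eval N h env a) (eval N h env b).
Proof. by rewrite maxnC maxnE addnC. Qed.

Lemma eval_foldr_EMaxn (a : expr) (F : nat -> expr) js :
  eval N h env (foldr (fun j => EMaxn (F j)) a js) =
  maxn (eval N h env a) (\max_(j <- js) eval N h env (F j)).
Proof.
elim: js => [|j js IH]; first by rewrite big_nil maxn0.
by rewrite [foldr _ _ _]/= eval_EMaxn IH big_cons maxnCA.
Qed.

End DerivedExpressions.

Lemma eval_ESum_gt0 N h env i a :
  (0 < eval N h env (ESum i a)) =
  [exists y : 'I_N, 0 < eval N h (set_reg env i y) a].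
Proof.
rewrite /= lt0n sum_nat_eq0 negb_forall; apply: eq_existsb => y.
by rewrite /= lt0n.
Qed.

Lemma eval_EFind N h env i a (p : pred 'I_N) (y0 : 'I_N) :
  i != bound_var -> p y0 ->
  (forall z (y : 'I_N),
     (0 < eval N h (set_reg (set_reg env bound_var z) i y) a) = p y) ->
  exists2 y : 'I_N, p y & eval N h env (EFind i a) = y.
Proof.
move=> i_b py0 aP; case: (arg_minnP (@nat_of_ord N) py0) => y py miny.
exists y => //; rewrite -[RHS]muln1 -(sum_ltn_ord _ (ltnW (ltn_ord y))).
apply: eq_bigr => z _; set env' := set_reg env bound_var z.
have leE (x : 'I_N) :
    (0 < eval N h (set_reg env' i x) (EAnd (ELeq i bound_var) a)) =
    (x <= z) && p x.
  rewrite eval_EAnd aP; congr andb.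
  rewrite /= set_regE set_reg_neq 1?eq_sym // /env' set_regE.
  by rewrite addn1 subn_gt0.
transitivity (nat_of_bool
    (~~ (0 < eval N h env' (ESum i (EAnd (ELeq i bound_var) a))))).
  exact: (eval_ENot N h env' (ESum i (EAnd (ELeq i bound_var) a))).
rewrite eval_ESum_gt0 (eq_existsb leE); case: ltnP => [ltzy|leyz].
  case: existsP => // -[x /andP[lexz px]].
  by have := leq_trans (miny x px) lexz; rewrite leqNgt ltzy.
by case: existsP => // -[]; exists y; rewrite leyz.
Qed.

(** * Tables *)

(* Cell [s] of table [k] has the address with base [N] digits 1, [k] and [s]:
   the leading 1 makes addresses of different lengths differ and keeps all of
   them above the input. *)
Definition addr (N : nat) (s : seq nat) : nat :=
  foldl (fun b x => b * N + x) 1 s.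

Lemma addr_rcons N s x : addr N (rcons s x) = addr N s * N + x.
Proof. by rewrite /addr foldl_rcons. Qed.

Lemma addr_gt0 N s : 0 < N -> 0 < addr N s.
Proof.
move=> N_gt0; elim/last_ind: s => // s x IH; rewrite addr_rcons.
by rewrite addn_gt0 muln_gt0 IH N_gt0.
Qed.

Lemma addr_ge N k s : 0 < N -> N <= addr N (k :: s).
Proof.
move=> N_gt0; case/lastP E: (k :: s) => [|s' x] //; rewrite addr_rcons.
by apply: leq_trans (leq_addr _ _); rewrite leq_pmull // addr_gt0.
Qed.

Lemma addr_inj N s s' : 1 < N -> all (ltn^~ N) s -> all (ltn^~ N) s' ->
  addr N s = addr N s' -> s = s'.
Proof.
move=> N_gt1; have N_gt0 := ltnW N_gt1.
have addr_neq1 r y : addr N (rcons r y) <> 1.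
  by rewrite addr_rcons; have := addr_gt0 r N_gt0; nia.
elim/last_ind: s s' => [|s x IH] s'; case/lastP: s' => [|s' x'] //.
- by move=> _ _ /esym/addr_neq1.
- by move=> _ _ /addr_neq1.
rewrite !all_rcons !addr_rcons => /andP[ltx alls] /andP[ltx' alls'] eq_addr.
have eqs : addr N s = addr N s'.
  have := congr1 (divn^~ N) eq_addr.
  by rewrite !divnMDl // !divn_small // !addn0.
by rewrite (IH s') //; congr rcons; move: eq_addr; rewrite eqs => /addnI.
Qed.

Definition eaddr (k : nat) (vs : seq nat) : expr :=
  foldl (fun b i => EAdd (ESum digit_var b) (EVar i))
    (EAdd (ESum digit_var (EConst 1)) (EConst k)) vs.

Definition EFetch (k : nat) (vs : seq nat) : expr := ELoad (eaddr k vs).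

Definition CStore (k : nat) (vs : seq nat) (a : expr) : cmd :=
  CPut (eaddr k vs) a.

Definition CFors (vs : seq nat) (c : cmd) : cmd := foldr CFor c vs.

Lemma map_set_reg env i v vs :
  i \notin vs -> map (set_reg env i v) vs = map env vs.
Proof.
move=> ivs; apply/eq_in_map => j jvs; rewrite set_reg_neq //.
by apply: contraNneq ivs => <-.
Qed.

Lemma map_set_nth (S T : Type) (f : S -> T) x0 y0 s j x : j < size s ->
  map f (set_nth x0 s j x) = set_nth y0 (map f s) j (f x).
Proof.
by move=> ltj; rewrite !set_nthE size_map ltj map_cat /= map_take map_drop.
Qed.

Lemma notin_set_nth (T : eqType) (x0 : T) s j x y :
  j < size s -> y \notin s -> y != x -> y \notin set_nth x0 s j x.
Proof.
move=> ltj ys yx; rewrite set_nthE ltj mem_cat inE (negPf yx) /= -mem_cat.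
by apply: contra ys; rewrite mem_cat => /orP[/mem_take|/mem_drop].
Qed.

Lemma run_CSeq N env c1 c2 st :
  run N env (CSeq c1 c2) st = run N env c2 (run N env c1 st).
Proof. by []. Qed.

Lemma run_CLet N env i a c st :
  run N env (CLet i a c) st = run N (set_reg env i (eval N st.1 env a)) c st.
Proof. by []. Qed.

Lemma run_CIf N env a c st :
  run N env (CIf a c) st = if 0 < eval N st.1 env a then run N env c st else st.
Proof. by []. Qed.

Lemma run_CPrint N env a st :
  run N env (CPrint a) st = (st.1, rcons st.2 (0 < eval N st.1 env a)).
Proof. by []. Qed.

Lemma run_CFor_ind N env i c (I : nat -> state -> Prop) st : I 0 st ->
  (forall (y : 'I_N) st, I y st -> I y.+1 (run N (set_reg env i y) c st)) ->
  I N (run N env (CFor i c) st).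
Proof.
move=> I0 IS /=; have: N <= N by [].
elim: {1 3 4}N => //= m IH ltmN; exact: (IS (Ordinal ltmN)) (IH (ltnW ltmN)).
Qed.

Lemma eval_eaddr N h env k vs : digit_var \notin vs ->
  eval N h env (eaddr k vs) = addr N (k :: map env vs).
Proof.
elim/last_ind: vs env => [|vs x IH] env.
  by rewrite /= sum_const_ord /addr /=.
rewrite mem_rcons in_cons negb_or => /andP[_ vs0].
rewrite /eaddr foldl_rcons /= -/(eaddr k vs) map_rcons -rcons_cons addr_rcons.
rewrite -(sum_const_ord N); congr addn; apply: eq_bigr => y _.
by rewrite IH // map_set_reg.
Qed.

Lemma iteri_foldl_enum (S : Type) (f : nat -> S -> S) N s :
  iteri N f s = foldl (fun s (y : 'I_N) => f y s) s (enum 'I_N).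
Proof.
have -> : foldl (fun s (y : 'I_N) => f y s) s (enum 'I_N) =
    foldl (fun s y => f y s) s (map val (enum 'I_N)).
  by elim: (enum _) s => //= y ys IH s.
rewrite val_enum_ord; elim: N => // N IH.
by rewrite [LHS]/= IH -[in RHS]addn1 iotaD foldl_cat.
Qed.

Fixpoint sequences (N m : nat) : seq (seq 'I_N) :=
  if m is m'.+1 then [seq y :: s | y <- enum 'I_N, s <- sequences N m']
  else [:: [::]].

Lemma mem_sequences N m (s : seq 'I_N) : (s \in sequences N m) = (size s == m).
Proof.
elim: m s => [|m IH] [|y s] //=.
  by apply/negbTE/negP => /allpairsP[[z s'] [_ _]].
rewrite eqSS -IH; apply/allpairsP/idP => [[[z s'] [_ + [_ ->]]] //|sm].
by exists (y, s); rewrite mem_enum.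
Qed.

Fixpoint binds (env : nat -> nat) (vs zs : seq nat) : nat -> nat :=
  match vs, zs with
  | x :: vs', z :: zs' => binds (set_reg env x z) vs' zs'
  | _, _ => env
  end.

Lemma binds_notin env vs zs i : i \notin vs -> binds env vs zs i = env i.
Proof.
elim: vs env zs => [|x vs IH] env [|z zs] //=; rewrite in_cons negb_or.
by move=> /andP[ix ivs]; rewrite IH // set_reg_neq.
Qed.

Lemma map_binds env vs zs :
  uniq vs -> size zs = size vs -> map (binds env vs zs) vs = zs.
Proof.
elim: vs env zs => [|x vs IH] env [|z zs] //= /andP[xvs Uvs] [sizezs].
by rewrite binds_notin // set_regE IH.
Qed.

Lemma run_CFors N env vs c st :
  run N env (CFors vs c) st =
  foldl (fun st s => run N (binds env vs (map val s)) c st) st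
    (sequences N (size vs)).
Proof.
elim: vs env st => [|x vs IH] env st //=; rewrite iteri_foldl_enum.
elim: (enum _) st => //= y ys IHys st; rewrite foldl_cat -IHys IH; congr foldl.
elim: (sequences _ _) st => //= s ss IHss st; exact: IHss.
Qed.

Section Tables.

Variable N : nat.
Hypothesis N_gt1 : 1 < N.

Implicit Types (h env : nat -> nat) (o : seq bool) (k v : nat) (p s : seq 'I_N).

Definition cell h k s : nat := h (addr N (k :: map val s)).

Definition put_cell h k s v : nat -> nat :=
  set_reg h (addr N (k :: map val s)) v.

Lemma cell_put h k s v k' s' : k < N -> k' < N ->
  cell (put_cell h k s v) k' s' =
  if (k' == k) && (s' == s) then v else cell h k' s'.
Proof.
move=> ltk ltk'.
have digits k1 s1 : k1 < N -> all (ltn^~ N) (k1 :: map val s1).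
  by move=> /= ->; apply/allP => _ /mapP[x _ ->] /=.
rewrite /cell /put_cell /set_reg; congr (if _ then _ else _).
apply/eqP/andP => [eq_addr|[/eqP-> /eqP->] //].
have [-> /(inj_map val_inj)-> //] :=
  addr_inj N_gt1 (digits _ _ ltk') (digits _ _ ltk) eq_addr.
Qed.

Lemma eval_EFetch h env k vs s :
  digit_var \notin vs -> map env vs = map val s ->
  eval N h env (EFetch k vs) = cell h k s.
Proof. by move=> digit vsE; rewrite [LHS]/= eval_eaddr ?vsE. Qed.

Lemma run_CStore h o env k vs s a :
  digit_var \notin vs -> map env vs = map val s ->
  run N env (CStore k vs a) (h, o) = (put_cell h k s (eval N h env a), o).
Proof. by move=> digit vsE; rewrite [LHS]/= eval_eaddr ?vsE. Qed.

(* The addresses below [N] hold the input. *)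
Definition changes_only (T : nat -> seq 'I_N -> bool) h h' : Prop :=
  (forall a, a < N -> h' a = h a) /\
  (forall k s, k < N -> ~~ T k s -> cell h' k s = cell h k s).

Lemma changes_only_trans T h1 h2 h3 :
  changes_only T h1 h2 -> changes_only T h2 h3 -> changes_only T h1 h3.
Proof.
move=> [in12 out12] [in23 out23]; split=> [a lta|k s ltk Tks].
  by rewrite in23 ?in12.
by rewrite out23 ?out12.
Qed.

Lemma changes_only_put (T : nat -> seq 'I_N -> bool) h k s v : k < N -> T k s ->
  changes_only T h (put_cell h k s v).
Proof.
move=> ltk Tks; split=> [a lta|k' s' ltk' Tks'].
  apply: set_reg_neq; rewrite neq_ltn; apply/orP; left.
  exact: leq_trans lta (addr_ge _ _ (ltnW N_gt1)).
rewrite cell_put //; case: andP => // -[/eqP Ek /eqP Es].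
by rewrite Ek Es Tks in Tks'.
Qed.

Definition row k p : nat -> seq 'I_N -> bool :=
  fun k' s => (k' == k) && prefix p s.

Lemma foldl_put_row k p h o (F : seq 'I_N -> nat) visit ss : k < N ->
  {in ss, forall s h1, changes_only (row k p) h h1 ->
     cell h1 k (p ++ s) \in [:: cell h k (p ++ s); F s] ->
     visit (h1, o) s = (put_cell h1 k (p ++ s) (F s), o)} ->
  exists h', [/\ foldl visit (h, o) ss = (h', o), changes_only (row k p) h h' &
    forall s, cell h' k (p ++ s) = if s \in ss then F s else cell h k (p ++ s)].
Proof.
move=> ltk; elim/last_ind: ss => [|ss s IH] visitE; first by exists h.
have [|h1 [foldE ch cellE]] := IH.
  by move=> s' s'ss; apply: visitE; rewrite mem_rcons inE s'ss orbT.
exists (put_cell h1 k (p ++ s) (F s)); split=> [||s'].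
- rewrite foldl_rcons foldE visitE ?mem_rcons ?mem_head // cellE !inE.
  by case: ifP; rewrite eqxx ?orbT.
- apply: changes_only_trans ch _; apply: changes_only_put => //.
  by rewrite /row eqxx prefix_prefix.
- rewrite cell_put // eqxx eqseq_cat // eqxx /= mem_rcons inE cellE.
  by case: eqP => // ->.
Qed.

(* The value stored in a cell may depend on the previous value of that cell, as
   long as storing it again does not change it. *)
Lemma run_fill_row env k us vs p a h o (F : seq 'I_N -> nat) :
  k < N -> uniq vs -> {in us, forall i, i \notin vs} ->
  digit_var \notin us -> digit_var \notin vs -> map env us = map val p ->
  (forall h1 env1 s, changes_only (row k p) h h1 ->
     cell h1 k (p ++ s) \in [:: cell h k (p ++ s); F s] ->
     (forall i, i \notin vs -> env1 i = env i) -> map env1 vs = map val s ->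
     eval N h1 env1 a = F s) ->
  exists h', [/\ run N env (CFors vs (CStore k (us ++ vs) a)) (h, o) = (h', o),
    changes_only (row k p) h h' &
    forall s, size s = size vs -> cell h' k (p ++ s) = F s].
Proof.
move=> ltk Uvs us_vs us_digit vs_digit usE aE; rewrite run_CFors.
have digit : digit_var \notin us ++ vs by rewrite mem_cat negb_or us_digit.
set visit := (fun st s => run N _ _ st).
have [|h' [-> ch cellE]] :=
  @foldl_put_row k p h o F visit (sequences N (size vs)) ltk.
  move=> s; rewrite mem_sequences => /eqP sizes h1 ch old.
  have vsE : map (binds env vs (map val s)) vs = map val s.
    by rewrite map_binds // size_map.
  rewrite /visit (@run_CStore _ _ _ _ _ (p ++ s)) // ?(aE _ _ s) //.
    by move=> i ivs; apply: binds_notin.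
  rewrite !map_cat vsE -usE; congr (_ ++ _); apply/eq_in_map => i /us_vs.
  exact: binds_notin.
by exists h'; split=> // s /eqP sizes; rewrite cellE mem_sequences sizes.
Qed.

End Tables.

(** * The program *)

Definition order_var := 3.
Definition pad_var := 4.
Definition target_var := 5.
Definition tested_var := 6.
Definition round_var := 7.
Definition pivot_var := 8.
Definition root_var := 9.
Definition left_var := 10.
Definition right_var := 11.
Definition colour_vars (t : nat) : seq nat := iota 12 t.

(* The first three tables hold flags. The entry of [value_tab] at [w :: xs] is
   the optimum on the block of the root [w] when [xs_j] is the only vertex of
   colour [j] outside the block that may have neighbours in it; an isolated
   vertex stands for the absence of such a vertex. *)
Definition deleted_tab := 0.
Definition eliminated_tab := 1.
Definition root_tab := 2.
Definition value_tab := 3.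

Definition EDeleted i := EFetch deleted_tab [:: i].
Definition EEliminated i := EFetch eliminated_tab [:: i].
Definition ERoot i := EFetch root_tab [:: i].

Definition EAdj (i j : nat) : expr :=
  EAnd (ESub (EVar order_var) (EVar i))
    (EAnd (ESub (EVar order_var) (EVar j))
      (ELoad (EAdd (EMul i order_var) (EVar j)))).

Definition EDistinct (i j : nat) : expr :=
  EAdd (ESub (EVar i) (EVar j)) (ESub (EVar j) (EVar i)).

Definition ESimplicial (i : nat) : expr :=
  EAnd (ENot (EEliminated i))
    (ENot (ESum left_var (ESum right_var
      (EAnd (EAnd (ENot (EEliminated left_var)) (EAdj i left_var))
      (EAnd (EAnd (ENot (EEliminated right_var)) (EAdj i right_var))
      (EAnd (EDistinct left_var right_var)
        (ENot (EAdj left_var right_var)))))))).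

Definition EBlocks (ys : seq nat) : expr :=
  ESum root_var (EIf (EAnd (ERoot root_var) (EAdj root_var pivot_var))
    (EFetch value_tab (root_var :: ys)) (EConst 0)).

(* Once the pivot has colour [j] it can replace the [j]-th outside vertex, which
   is not adjacent to it and so has no neighbour in the blocks that it joins. *)
Definition EColour (ys : seq nat) (j : nat) : expr :=
  EIf (EAnd (ENot (EDeleted pivot_var)) (ENot (EAdj (nth 0 ys j) pivot_var)))
    (EAdd (EConst 1) (EBlocks (set_nth 0 ys j pivot_var))) (EConst 0).

Definition EValue (ys : seq nat) : expr :=
  foldr (fun j => EMaxn (EColour ys j)) (EBlocks ys) (iota 0 (size ys)).

Definition CValueRow (t : nat) : cmd :=
  CFors (colour_vars t)
    (CStore value_tab (pivot_var :: colour_vars t) (EValue (colour_vars t))).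

Definition CUnroot : cmd :=
  CFors [:: root_var] (CStore root_tab [:: root_var]
    (EAnd (ERoot root_var) (ENot (EAdj root_var pivot_var)))).

Definition CRound (t : nat) : cmd :=
  CLet pivot_var (EFind pivot_var (ESimplicial pivot_var))
  (CSeq (CValueRow t)
  (CSeq CUnroot
  (CSeq (CStore eliminated_tab [:: pivot_var] (EConst 1))
        (CStore root_tab [:: pivot_var] (EConst 1))))).

Definition CClear (k : nat) : cmd :=
  CFors [:: root_var] (CStore k [:: root_var] (EConst 0)).

Definition COptimum (t : nat) : cmd :=
  CSeq (CClear eliminated_tab)
  (CSeq (CClear root_tab) (CFor round_var (CRound t))).

Definition EOptimum (t : nat) : expr :=
  ESum root_var (EIf (ERoot root_var)
    (EFetch value_tab (root_var :: nseq t pad_var)) (EConst 0)).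

Definition ESize : expr := ESum digit_var (EConst 1).

Definition ESuccSquare (i : nat) : expr :=
  EAdd (EMul i i) (EAdd (EVar i) (EAdd (EVar i) (EConst 1))).

(* The input is an adjacency matrix and [N - 4] is its length, so its order is
   the number of [z] with [(z + 1) ^ 2 <= N - 4]. *)
Definition EOrder : expr :=
  ESum left_var (ENot (ESub (ESuccSquare left_var) (ESub ESize (EConst 4)))).

Definition CTest (t : nat) : cmd :=
  CSeq (CStore deleted_tab [:: tested_var] (EConst 1))
  (CSeq (COptimum t)
        (CIf (ESub (EVar target_var) (EOptimum t))
          (CStore deleted_tab [:: tested_var] (EConst 0)))).

Definition CDelete (t : nat) : cmd := CFor tested_var (CTest t).

Definition COutput : cmd :=
  CFor tested_var (CIf (ESub (EVar order_var) (EVar tested_var))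
    (CPrint (EDeleted tested_var))).

Definition CMain (t : nat) : cmd :=
  CLet order_var EOrder
  (CLet pad_var (ESub ESize (EConst 1))
  (CSeq (COptimum t)
  (CLet target_var (EOptimum t) (CSeq (CDelete t) COutput)))).

(** * Correctness of the program *)

Section Correctness.

Variables (N n t : nat) (e : rel 'I_N).
Hypotheses (e_sym : symmetric e) (e_irr : irreflexive e).
Hypothesis sizeN : n * n + 4 = N.
Hypothesis e_lt : forall x y, e x y -> x < n.

Let H : sgraph := SGraph e_sym e_irr.

Hypothesis chH : chordal H.

Let N_gt3 : 3 < N. Proof. by rewrite -sizeN leq_addl. Qed.
Let tab_lt k : k <= value_tab -> k < N.
Proof. by move=> lek; apply: leq_ltn_trans N_gt3. Qed.
Let N_gt1 : 1 < N. Proof. exact: ltn_trans N_gt3. Qed.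
Let pad_lt : N.-1 < N. Proof. by rewrite prednK // ltnW. Qed.
Let pad : 'I_N := Ordinal pad_lt.

Implicit Types (h env : nat -> nat) (o : seq bool) (k : nat) (u v w x y : 'I_N).
Implicit Types (T : nat -> seq 'I_N -> bool) (A D R : {set 'I_N}).
Implicit Types (rt : 'I_N -> 'I_N) (xs s : seq 'I_N).

Lemma pad_isolated u : ~~ e pad u.
Proof. by apply: contraT => /negbNE/e_lt /=; have := sizeN; nia. Qed.

Definition holds_graph h : Prop :=
  forall x y, x < n -> y < n -> h (x * n + y) = e x y.

Lemma eval_EAdj h env i j x y : holds_graph h -> env order_var = n ->
  i != factor_var -> env i = x -> env j = y ->
  (0 < eval N h env (EAdj i j)) = e x y.
Proof.
move=> graph orderE i_f ix jy; rewrite !eval_EAnd.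
have -> : eval N h env (ELoad (EAdd (EMul i order_var) (EVar j))) =
    h (x * n + y).
  transitivity (h (eval N h env (EMul i order_var) + env j)) => //.
  by rewrite eval_EMul ?ix ?jy ?orderE // ltnW.
rewrite /= ix jy orderE !subn_gt0; case: (ltnP x n) => [ltxn|lenx]; last first.
  by apply/esym/negbTE/negP => /e_lt; rewrite ltnNge lenx.
case: (ltnP y n) => [ltyn|leny]; first by rewrite graph // lt0b.
by apply/esym/negbTE/negP; rewrite e_sym => /e_lt; rewrite ltnNge leny.
Qed.

Definition flags h k (S : {set 'I_N}) : Prop :=
  forall w, cell h k [:: w] = (w \in S).

Record tables h D A R : Prop := Tables {
  tables_graph : holds_graph h;
  tables_deleted : flags h deleted_tab D;
  tables_eliminated : flags h eliminated_tab (~: A);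
  tables_root : flags h root_tab R
}.

Lemma eval_flag h env k (S : {set 'I_N}) i w : flags h k S ->
  i != digit_var -> env i = w ->
  (0 < eval N h env (EFetch k [:: i])) = (w \in S).
Proof.
move=> flagS i_d iw.
rewrite (@eval_EFetch N _ _ _ _ [:: w]) ?inE 1?eq_sym //= ?iw //.
by rewrite flagS lt0b.
Qed.

Lemma eval_EEliminated h env D A R i w : tables h D A R ->
  i != digit_var -> env i = w ->
  (0 < eval N h env (EEliminated i)) = (w \notin A).
Proof.
move=> tab i_d iw.
by rewrite (eval_flag (tables_eliminated tab) i_d iw) in_setC.
Qed.

Lemma eval_ERoot h env D A R i w : tables h D A R ->
  i != digit_var -> env i = w -> (0 < eval N h env (ERoot i)) = (w \in R).
Proof. by move=> tab; apply/eval_flag/(tables_root tab). Qed.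

Lemma eval_EDeleted h env D i w : flags h deleted_tab D ->
  i != digit_var -> env i = w -> (0 < eval N h env (EDeleted i)) = (w \in D).
Proof. exact: eval_flag. Qed.

Lemma eval_EDistinct h env i j x y : env i = x -> env j = y ->
  (0 < eval N h env (EDistinct i j)) = (x != y).
Proof. by move=> /= -> ->; rewrite -val_eqE /=; lia. Qed.

Lemma eval_ESimplicial h env D A R v : tables h D A R -> env order_var = n ->
  env pivot_var = v -> (0 < eval N h env (ESimplicial pivot_var)) =
  (v \in A) && ~~ @nonadjacent_neighbours H A v.
Proof.
move=> tab orderE pivotE; have graph := tables_graph tab.
rewrite eval_EAnd !eval_ENot !lt0b (eval_EEliminated tab _ pivotE) // negbK.
congr (_ && ~~ _); rewrite eval_ESum_gt0; apply: eq_existsb => x.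
rewrite eval_ESum_gt0; apply: eq_existsb => y.
set env' := set_reg (set_reg env left_var x) right_var y.
have [leftE rightE pivotE' orderE'] : [/\ env' left_var = x, env' right_var = y,
  env' pivot_var = v & env' order_var = n] by [].
rewrite 2!eval_EAnd (eval_EAdj graph orderE' _ pivotE' leftE) //.
rewrite 2!eval_EAnd (eval_EAdj graph orderE' _ pivotE' rightE) //.
rewrite eval_EAnd !eval_ENot !lt0b.
rewrite (eval_EAdj graph orderE' _ leftE rightE) //.
rewrite (eval_EEliminated tab _ leftE) // (eval_EEliminated tab _ rightE) //.
by rewrite !negbK (eval_EDistinct _ leftE rightE).
Qed.

Lemma eval_pivot h env D A R :
  tables h D A R -> env order_var = n -> A != set0 ->
  exists v, [/\ v \in A, @simplicial H A v &
    eval N h env (EFind pivot_var (ESimplicial pivot_var)) = v].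
Proof.
move=> tab orderE nzA.
have [v vA /simplicialP simpv] := @chordal_simplicial H A chH nzA.
pose good y := (y \in A) && ~~ @nonadjacent_neighbours H A y.
have [|||y /andP[yA /simplicialP simpy] ->] :=
  @eval_EFind N h env pivot_var (ESimplicial pivot_var) good v.
- by [].
- by rewrite /good vA.
- by move=> z y; apply: (eval_ESimplicial tab).
by exists y.
Qed.

Definition blocks_value h R v xs : nat :=
  \sum_(w in R | e w v) cell h value_tab (w :: xs).

Lemma eval_EBlocks h env D A R v xs ys : tables h D A R ->
  env order_var = n -> env pivot_var = v ->
  digit_var \notin ys -> root_var \notin ys -> map env ys = map val xs ->
  eval N h env (EBlocks ys) = blocks_value h R v xs.
Proof.
move=> tab orderE pivotE ys_d ys_r ysE; rewrite [RHS]big_mkcond.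
apply: eq_bigr => w _; set env' := set_reg env root_var w.
have [rootE pivotE' orderE'] :
  [/\ env' root_var = w, env' pivot_var = v & env' order_var = n] by [].
transitivity (
  if 0 < eval N h env' (EAnd (ERoot root_var) (EAdj root_var pivot_var))
  then eval N h env' (EFetch value_tab (root_var :: ys)) else 0) => //.
rewrite eval_EAnd (eval_ERoot tab _ rootE) //.
rewrite (eval_EAdj (tables_graph tab) orderE' _ rootE pivotE') //.
by rewrite (@eval_EFetch N _ _ _ _ (w :: xs)) ?inE //= rootE map_set_reg // ysE.
Qed.

Lemma eval_EColour h env D A R v xs ys j : tables h D A R ->
  env order_var = n -> env pivot_var = v -> j < size ys ->
  digit_var \notin ys -> root_var \notin ys -> factor_var \notin ys ->
  map env ys = map val xs ->
  eval N h env (EColour ys j) =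
  if (v \notin D) && ~~ e (nth pad xs j) v then
    (blocks_value h R v (set_nth pad xs j v)).+1
  else 0.
Proof.
move=> tab orderE pivotE ltj ys_d ys_r ys_f ysE.
have sizeE : size ys = size xs by have := congr1 size ysE; rewrite !size_map.
have colourE : env (nth 0 ys j) = nth pad xs j.
  by rewrite -(nth_map 0 0) // ysE (nth_map pad) -?sizeE.
have j_f : nth 0 ys j != factor_var.
  by apply: contraNneq ys_f => <-; apply: mem_nth.
transitivity (if 0 < eval N h env (EAnd (ENot (EDeleted pivot_var))
    (ENot (EAdj (nth 0 ys j) pivot_var)))
  then 1 + eval N h env (EBlocks (set_nth 0 ys j pivot_var)) else 0) => //.
rewrite eval_EAnd !eval_ENot !lt0b.
rewrite (eval_EDeleted (tables_deleted tab) _ pivotE) //.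
rewrite (eval_EAdj (tables_graph tab) orderE j_f colourE pivotE) //.
case: ifP => // _; rewrite add1n; congr _.+1.
apply: (eval_EBlocks tab) => //; try exact: notin_set_nth.
by rewrite (map_set_nth _ _ 0) // pivotE ysE (map_set_nth _ _ 0) -?sizeE.
Qed.

Definition row_value h D R v xs : nat :=
  maxn (blocks_value h R v xs)
    (\max_(j < t | (v \notin D) && ~~ e (nth pad xs j) v)
      (blocks_value h R v (set_nth pad xs j v)).+1).

Lemma eval_EValue h env D A R v xs ys : tables h D A R ->
  env order_var = n -> env pivot_var = v -> size ys = t ->
  digit_var \notin ys -> root_var \notin ys -> factor_var \notin ys ->
  map env ys = map val xs -> eval N h env (EValue ys) = row_value h D R v xs.
Proof.
move=> tab orderE pivotE sizeys ys_d ys_r ys_f ysE.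
rewrite eval_foldr_EMaxn (eval_EBlocks tab orderE pivotE ys_d ys_r ysE).
congr maxn; rewrite sizeys -[t in iota 0 t]subn0 big_mkord [RHS]big_mkcond.
by apply: eq_bigr => j _; apply: (eval_EColour tab) => //; rewrite sizeys.
Qed.

Record dp_state h D A rt : Prop := DpState {
  dp_tables : tables h D A (@block_roots H A rt);
  dp_elimination : @elimination H A rt;
  dp_value : forall w xs, w \in @block_roots H A rt -> size xs = t ->
    all (@remaining_or_isolated H A) xs ->
    cell h value_tab (w :: xs) =
    max_colourable (@boundary H t (fun j => nth pad xs j))
      (@block H A rt w :\: D)
}.

Lemma holds_graph_changes T h h' :
  changes_only T h h' -> holds_graph h -> holds_graph h'.
Proof.
move=> [low _] graph x y ltxn ltyn; rewrite low ?graph //.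
by have := sizeN; nia.
Qed.

Lemma holds_graph_put h k s (c : nat) : k < N ->
  holds_graph h -> holds_graph (put_cell h k s c).
Proof.
move=> ltk; apply: holds_graph_changes.
exact: (@changes_only_put N N_gt1 (fun _ _ => true)).
Qed.

Lemma flags_changes T h h' k S : changes_only T h h' -> k < N ->
  (forall w, ~~ T k [:: w]) -> flags h k S -> flags h' k S.
Proof. by move=> [_ outside] ltk Tk flagS w; rewrite outside. Qed.

Lemma flags_put h k S v (b : bool) : k < N -> flags h k S ->
  flags (put_cell h k [:: v] b) k (if b then v |: S else S :\ v).
Proof.
move=> ltk flagS w; rewrite cell_put // eqxx eqseq_cons andbT /=.
by case: b; rewrite !inE; case: eqP => // _; rewrite flagS.
Qed.

Lemma new_block_value h D A rt v xs : dp_state h D A rt -> v \in A ->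
  size xs = t -> all (@remaining_or_isolated H (A :\ v)) xs ->
  row_value h D (@block_roots H A rt) v xs =
  max_colourable (@boundary H t (fun j => nth pad xs j))
    (@block H (A :\ v) (@reroot H A rt v) v :\: D).
Proof.
move=> [tab elimA valueE] vA sizexs xsA.
rewrite (@max_colourable_new_block H) // => [|j]; last first.
  by apply: (allP xsA); rewrite mem_nth // sizexs.
have xsA' : all (@remaining_or_isolated H A) xs.
  by apply: sub_all xsA => x; apply/remaining_or_isolatedW/subD1set.
congr maxn; first by apply: eq_bigr => w /andP[wR _]; apply: valueE.
apply: eq_bigr => j _; congr _.+1; apply: eq_bigr => w /andP[wR _].
have ltj : j < size xs by rewrite sizexs.
rewrite valueE //; first 1 last.
- by rewrite size_set_nth sizexs; apply/maxn_idPr.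
- have vA' : @remaining_or_isolated H A v by apply/orP; left.
  rewrite set_nthE ltj all_cat /= vA' -all_cat; apply/allP => x.
  by rewrite mem_cat => /orP[/mem_take|/mem_drop]; apply/allP.
by apply: eq_max_colourable => u _ i; rewrite /boundary nth_set_nth.
Qed.

Lemma tables_changes T h h' D A R : changes_only T h h' ->
  (forall k w, k < value_tab -> ~~ T k [:: w]) ->
  tables h D A R -> tables h' D A R.
Proof.
move=> ch notT [graph del elim root]; split.
  exact: (holds_graph_changes ch).
all: by apply: (flags_changes ch) => [|w|]; [exact: tab_lt | exact: notT |].
Qed.

Lemma row_changes h h' D R v xs : changes_only (row value_tab [:: v]) h h' ->
  v \notin R -> row_value h' D R v xs = row_value h D R v xs.
Proof.
move=> [_ outside] vR.
have blocksE ys : blocks_value h' R v ys = blocks_value h R v ys.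
  apply: eq_bigr => w /andP[wR _]; apply: outside => //.
  by rewrite /row eqxx /=; apply: contraNN vR => /andP[/eqP->].
rewrite /row_value blocksE; congr maxn.
by apply: eq_bigr => j _; rewrite blocksE.
Qed.

Lemma run_value_row env h o D A R v : tables h D A R -> v \notin R ->
  env order_var = n -> env pivot_var = v ->
  exists h', [/\ run N env (CValueRow t) (h, o) = (h', o),
    changes_only (row value_tab [:: v]) h h' &
    forall xs, size xs = t ->
      cell h' value_tab (v :: xs) = row_value h D R v xs].
Proof.
move=> tab vR orderE pivotE.
have [||||||h1 env1 xs ch _ envE xsE|h' [runE ch valueE]] :=
  @run_fill_row N N_gt1 env value_tab [:: pivot_var] (colour_vars t) [:: v]
    (EValue (colour_vars t)) h o (row_value h D R v).
- by [].
- exact: iota_uniq.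
- by move=> i; rewrite inE => /eqP->; rewrite mem_iota.
- by [].
- by rewrite mem_iota.
- by rewrite /= pivotE.
- have tab1 : tables h1 D A R.
    by apply: tables_changes ch _ tab => k w ltk; rewrite /row ltn_eqF.
  rewrite (eval_EValue tab1 (v := v) (xs := xs)) ?envE ?mem_iota ?size_iota //.
  exact: row_changes.
by exists h'; split=> // xs sizexs; apply: valueE; rewrite size_iota.
Qed.

Lemma run_unroot env h o D A R v : tables h D A R ->
  env order_var = n -> env pivot_var = v ->
  exists h', [/\ run N env CUnroot (h, o) = (h', o),
    tables h' D A [set w in R | ~~ e w v] &
    forall s, cell h' value_tab s = cell h value_tab s].
Proof.
move=> tab orderE pivotE.
pose F s := (head pad s \in R) && ~~ e (head pad s) v : nat.
have [||||||h1 env1 s ch old envE sE|h' [runE ch rootE]] :=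
  @run_fill_row N N_gt1 env root_tab [::] [:: root_var] [::]
    (EAnd (ERoot root_var) (ENot (EAdj root_var pivot_var))) h o F => //.
- exact: tab_lt.
- case: s sE old => [|w [|? ?]] //= [rootE]; rewrite inE => old.
  have graph1 : holds_graph h1.
    by apply: (holds_graph_changes ch (tables_graph tab)).
  transitivity (if 0 < eval N h1 env1 (ERoot root_var)
    then eval N h1 env1 (ENot (EAdj root_var pivot_var)) else 0) => //.
  rewrite (@eval_EFetch N _ _ _ _ [:: w]) ?[map _ _]/= ?rootE // eval_ENot.
  rewrite (eval_EAdj graph1 _ _ rootE (y := v)) ?envE // /F /=.
  move: old; rewrite (tables_root tab w) /F /= inE.
  by case: (w \in R); case: (e w v) => /orP[] /eqP->.
exists h'; split=> // [|s]; last by apply: ch.2.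
split.
- exact: (holds_graph_changes ch (tables_graph tab)).
- by apply: flags_changes ch _ _ (tables_deleted tab) => //; apply: tab_lt.
- by apply: flags_changes ch _ _ (tables_eliminated tab) => //; apply: tab_lt.
- by move=> w; rewrite (rootE [:: w]) // inE.
Qed.

Lemma tables_eliminate h D A R v : tables h D A R ->
  tables (put_cell (put_cell h eliminated_tab [:: v] 1) root_tab [:: v] 1)
    D (A :\ v) (v |: R).
Proof.
move=> tab; set h1 := put_cell h _ _ _; set h2 := put_cell h1 _ _ _.
pose T k s := (k \in [:: eliminated_tab; root_tab]) && (s == [:: v]).
have ch : changes_only T h h2.
  by apply: (@changes_only_trans _ _ _ h1); apply: changes_only_put => //;
    rewrite ?tab_lt // /T eqxx.
split.
- exact: (holds_graph_changes ch (tables_graph tab)).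
- by apply: flags_changes ch _ _ (tables_deleted tab) => //; apply: tab_lt.
- move=> w; rewrite cell_put ?tab_lt //=.
  rewrite (@flags_put h eliminated_tab (~: A) v true) ?tab_lt //; last first.
    exact: tables_eliminated tab.
  by rewrite !inE negb_and negbK.
- apply: (@flags_put h1 root_tab R v true) => [|w]; first exact: tab_lt.
  by rewrite cell_put ?tab_lt //=; apply: tables_root tab w.
Qed.

Lemma run_CRound env h o D A rt : dp_state h D A rt -> env order_var = n ->
  A != set0 -> exists h' v, [/\ run N env (CRound t) (h, o) = (h', o), v \in A &
    dp_state h' D (A :\ v) (@reroot H A rt v)].
Proof.
move=> dp orderE nzA; have [tab elimA valueE] := dp.
have [v [vA simpv pivotE]] := eval_pivot tab orderE nzA.
have vR : v \notin @block_roots H A rt by rewrite !inE vA.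
rewrite /CRound run_CLet [(h, o).1]/= pivotE.
set env' := set_reg env pivot_var v.
have [orderE' pivotE'] : env' order_var = n /\ env' pivot_var = v by [].
rewrite !run_CSeq.
have [h1 [-> ch1 rowE]] := run_value_row o tab vR orderE' pivotE'.
have tab1 : tables h1 D A (@block_roots H A rt).
  by apply: tables_changes ch1 _ tab => k w ltk; rewrite /row ltn_eqF.
have [h2 [-> tab2 valueE2]] := run_unroot o tab1 orderE' pivotE'.
rewrite !(@run_CStore N _ _ _ _ _ [:: v]) //; try by rewrite /= pivotE'.
set h3 := put_cell _ _ _ _; exists h3, v; split=> //.
have elim' := elimination_step elimA vA simpv; split=> //.
  rewrite block_roots_reroot //; exact: tables_eliminate tab2.
move=> w xs; rewrite block_roots_reroot // => wR sizexs xsA.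
rewrite /= !cell_put ?tab_lt //= -/(cell h2 value_tab (w :: xs)) valueE2.
case/setU1P: wR => [->|].
  by rewrite rowE //; apply: new_block_value.
rewrite inE => /andP[wR wv].
rewrite ch1.2 //; last first.
  by rewrite /row eqxx /=; apply: contraNN vR => /andP[/eqP->].
rewrite block_reroot_old // valueE //; apply: sub_all xsA => x.
exact/remaining_or_isolatedW/subD1set.
Qed.

Lemma eval_EOptimum h env D rt : dp_state h D set0 rt -> env pad_var = pad ->
  eval N h env (EOptimum t) = @max_colourable_without H t D.
Proof.
move=> [tab elim0 valueE] padE.
have -> : @max_colourable_without H t D =
    max_colourable (@boundary H t (fun=> pad))
      ([set u in ~: set0 | predT (rt u)] :\: D).
  rewrite setC0 (_ : finset _ = setT) ?setTD; last first.
    by apply/setP => u; rewrite !inE.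
  by apply: eq_max_colourable => u _ j; rewrite /boundary /= pad_isolated.
rewrite max_colourable_blocks // [RHS]big_mkcond; apply: eq_bigr => w _.
set env' := set_reg env root_var w; have rootE : env' root_var = w by [].
transitivity (if 0 < eval N h env' (ERoot root_var)
  then eval N h env' (EFetch value_tab (root_var :: nseq t pad_var))
  else 0) => //.
rewrite (eval_ERoot tab _ rootE) // andbT; case: ifP => // wR.
have padE' : env' pad_var = pad by [].
rewrite (@eval_EFetch N _ _ _ _ (w :: nseq t pad)); first 1 last.
- by rewrite inE mem_nseq andbF.
- by rewrite /= !map_nseq rootE padE'.
rewrite valueE ?size_nseq //; last first.
  rewrite all_nseq; apply/orP; right; apply/orP; right.
  exact/forallP/pad_isolated.
by apply: eq_max_colourable => u _ j; rewrite /boundary nth_nseq ltn_ord.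
Qed.

Lemma run_clear env h o k : k <= value_tab -> exists h',
  [/\ run N env (CClear k) (h, o) = (h', o),
    changes_only (@row N k [::]) h h' & flags h' k set0].
Proof.
move=> lek; have [|||||||h' [-> ch cellE]] := @run_fill_row N N_gt1 env k [::]
  [:: root_var] [::] (EConst 0) h o (fun=> 0) => //; first exact: tab_lt.
by exists h'; split=> // w; rewrite (cellE [:: w]) ?inE.
Qed.

Lemma run_COptimum env h o D : holds_graph h -> flags h deleted_tab D ->
  env order_var = n -> env pad_var = pad -> exists h',
  [/\ run N env (COptimum t) (h, o) = (h', o), holds_graph h',
    flags h' deleted_tab D &
    eval N h' env (EOptimum t) = @max_colourable_without H t D].
Proof.
move=> graph del orderE padE; rewrite /COptimum !run_CSeq.
have [h1 [-> ch1 elim1]] :=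
  run_clear env h o (isT : eliminated_tab <= value_tab).
have [h2 [-> ch2 root2]] :=
  run_clear env h1 o (isT : root_tab <= value_tab).
have dp2 : dp_state h2 D setT id.
  have roots0 : @block_roots H setT id = set0 by apply/setP => w; rewrite !inE.
  split; last by move=> w xs; rewrite roots0 inE.
    split; rewrite ?roots0 //.
    - exact: (holds_graph_changes ch2 (holds_graph_changes ch1 graph)).
    - apply: flags_changes ch2 (tab_lt _) _ _ => //.
      exact: flags_changes ch1 (tab_lt _) _ _.
    - by apply: flags_changes ch2 (tab_lt _) _ _; rewrite ?setCT.
  exact: eliminationT.
pose after (m : nat) (st : state) := exists h' A rt,
  [/\ st = (h', o), #|A| = N - m & dp_state h' D A rt].
have [h3 [A [rt [-> cardA dp3]]]] :
    after N (run N env (CFor round_var (CRound t)) (h2, o)).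
  apply: run_CFor_ind.
    by exists h2, setT, id; rewrite cardsT card_ord subn0.
  move=> y _ [h' [A [rt [-> cardA dp']]]].
  have nzA : A != set0 by rewrite -card_gt0 cardA subn_gt0.
  have [h'' [v [-> vA dp'']]] :=
    @run_CRound (set_reg env round_var y) h' o D A rt dp' orderE nzA.
  exists h'', (A :\ v), (@reroot H A rt v); split=> //.
  by rewrite subnS -cardA [in RHS](cardsD1 v) vA.
have A0 : A = set0 by apply/eqP; rewrite -cards_eq0 cardA subnn.
rewrite A0 in dp3; exists h3; split=> //; last exact: eval_EOptimum dp3 padE.
  exact: tables_graph (dp_tables dp3).
exact: tables_deleted (dp_tables dp3).
Qed.

Lemma run_CTest env h o D u : env order_var = n -> env pad_var = pad ->
  env target_var = @max_colourable_without H t set0 -> env tested_var = u ->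
  holds_graph h -> flags h deleted_tab D -> u \notin D -> exists h',
  [/\ run N env (CTest t) (h, o) = (h', o), holds_graph h' &
    flags h' deleted_tab
      (if @max_colourable_without H t (u |: D) <
          @max_colourable_without H t set0 then D else u |: D)].
Proof.
move=> orderE padE targetE testedE graph del uD; rewrite /CTest 2!run_CSeq.
have vsE : map env [:: tested_var] = map val [:: u] by rewrite /= testedE.
have del_lt : deleted_tab < N by apply: tab_lt.
rewrite (run_CStore _ _ _ _ _ vsE) // (_ : eval _ _ _ (EConst 1) = true) //.
have [h1 [-> graph1 del1 optE]] :=
  run_COptimum o (holds_graph_put _ _ del_lt graph)
    (flags_put u true del_lt del) orderE padE.
rewrite run_CIf.
rewrite (_ : eval _ _ _ _ = env target_var - eval N h1 env (EOptimum t)) //.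
rewrite targetE optE subn_gt0; case: ifP => _; last by exists h1.
rewrite (run_CStore _ _ _ _ _ vsE) //.
exists (put_cell h1 deleted_tab [:: u] 0); split=> //.
  exact: holds_graph_put.
by have := flags_put u false del_lt del1; rewrite setU1K.
Qed.

Lemma run_CDelete env h o : env order_var = n -> env pad_var = pad ->
  env target_var = @max_colourable_without H t set0 ->
  holds_graph h -> flags h deleted_tab set0 -> exists h' D,
  [/\ run N env (CDelete t) (h, o) = (h', o), flags h' deleted_tab D &
    critical (@max_colourable_without H t) setT D].
Proof.
move=> orderE padE targetE graph del.
pose after (m : nat) (st : state) := exists h' D,
  [/\ st = (h', o), holds_graph h', flags h' deleted_tab D,
    {in D, forall u, u < m} &
    critical (@max_colourable_without H t) [set u : 'I_N | u < m] D].
have [h' [D [-> _ del' _ crit]]] : after N (run N env (CDelete t) (h, o)).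
  apply: run_CFor_ind.
    exists h, set0; split=> //; first by move=> u; rewrite inE.
    by split=> // u; rewrite inE.
  move=> u _ [h1 [D [-> graph1 del1 ltD critD]]].
  have uD : u \notin D by apply/negP => /ltD; rewrite ltnn.
  have [h2 [-> graph2 del2]] :=
    @run_CTest (set_reg env tested_var u) h1 o D u orderE padE targetE erefl
      graph1 del1 uD.
  set D' := if _ then D else _ in del2 *; exists h2, D'; split=> //.
    move=> x xD'; have /setU1P[-> //|/ltD/ltnW //] : x \in u |: D.
    by move: xD'; rewrite /D'; case: ifP => // _ xD; apply: setU1r.
  have -> : [set x : 'I_N | x < u.+1] = u |: [set x : 'I_N | x < u].
    by apply/setP => x; rewrite !inE ltnS leq_eqVlt.
  apply: criticalU1 critD; exact: max_colourable_without_anti.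
exists h', D; split=> //.
suff <- : [set u : 'I_N | u < N] = [set: H] by [].
by apply/setP => u; rewrite !inE ltn_ord.
Qed.

Lemma run_COutput env h D : env order_var = n -> flags h deleted_tab D ->
  run N env COutput (h, [::]) = (h, take n (@encode_vset H D)).
Proof.
move=> orderE del; pose out := @encode_vset H D.
have size_out : size out = N by rewrite size_map -cardE card_ord.
have : run N env COutput (h, [::]) = (h, take (minn N n) out).
  apply: (@run_CFor_ind N env tested_var _
    (fun m st => st = (h, take (minn m n) out))).
    by rewrite min0n take0.
  move=> u _ ->; set env' := set_reg env tested_var u.
  have testedE : env' tested_var = u by [].
  rewrite run_CIf (_ : eval _ _ _ _ = n - u); last by rewrite /= -orderE.
  rewrite subn_gt0; case: ltnP => [ltun|leun].
    rewrite run_CPrint (eval_EDeleted del _ testedE) // (minn_idPl ltun).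
    rewrite (take_nth false) ?size_out //.
    congr (_, rcons _ _); rewrite (nth_map u) -?cardE ?card_ord //.
    by rewrite nth_ord_enum.
  by rewrite (minn_idPr (leqW leun)).
by move=> ->; rewrite (minn_idPr _) //; have := sizeN; nia.
Qed.

Lemma eval_ESize h env : eval N h env ESize = N.
Proof. by rewrite /= sum_const_ord mul1n. Qed.

Lemma eval_ESuccSquare h env i (z : 'I_N) : i != factor_var -> env i = z ->
  eval N h env (ESuccSquare i) = z.+1 * z.+1.
Proof.
move=> i_f iz.
transitivity (eval N h env (EMul i i) + (env i + (env i + 1))) => //.
by rewrite eval_EMul // iz; [lia | exact: ltnW (ltn_ord z)].
Qed.

Lemma eval_EOrder h env : eval N h env EOrder = n.
Proof.
have ltnN : n < N by have := sizeN; nia.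
rewrite -[RHS]muln1 -(sum_ltn_ord 1 (ltnW ltnN)); apply: eq_bigr => z _.
set env' := set_reg env left_var z; have leftE : env' left_var = z by [].
transitivity (nat_of_bool (~~ (0 < eval N h env' (ESuccSquare left_var) -
    (eval N h env' ESize - 4)))).
  exact: (eval_ENot N h env'
    (ESub (ESuccSquare left_var) (ESub ESize (EConst 4)))).
have subN4 : N - 4 = n * n by rewrite -[in LHS]sizeN addnK.
rewrite (eval_ESuccSquare _ _ leftE) // eval_ESize subN4.
by rewrite subn_gt0 -leqNgt !mulnn leq_sqr; case: ltnP.
Qed.

Lemma run_CMain env h : holds_graph h -> flags h deleted_tab set0 ->
  exists D : {set H},
    (run N env (CMain t) (h, [::])).2 = take n (encode_vset D) /\
    min_clique_deletion_set t.+1 D.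
Proof.
move=> graph del; rewrite /CMain !run_CLet eval_EOrder.
set env1 := set_reg env order_var n.
rewrite (_ : eval N _ env1 _ = pad); last first.
  by rewrite /= sum_const_ord mul1n subn1.
set env2 := set_reg env1 pad_var pad; rewrite run_CSeq.
have [h1 [-> graph1 del1 optE]] :=
  @run_COptimum env2 h [::] set0 graph del erefl erefl.
rewrite run_CLet run_CSeq optE; set env3 := set_reg env2 target_var _.
have [h2 [D [-> del2 crit]]] :=
  @run_CDelete env3 h1 [::] erefl erefl erefl graph1 del1.
rewrite (@run_COutput env3 h2 D) //; exists D; split=> //.
exact: min_clique_deletion_set_critical.
Qed.

End Correctness.

(** * Adding isolated vertices *)

Section IsolatedVertices.

Variables (G H : sgraph) (f : G -> H).
Hypothesis f_inj : injective f.
Hypothesis f_adj : forall x y, adj (f x) (f y) = adj x y.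
Hypothesis f_edge : forall u v, adj u v -> u \in codom f.

Lemma chordal_isolated : chordal G -> chordal H.
Proof.
move=> chG c cycc size_c; have /andP[cyc_c Uc] := cycc.
have [d cE] : exists d, c = map f d.
  have : all [in codom f] c.
    by apply/allP => u uc; apply: f_edge (next_cycle cyc_c uc).
  elim: (c) => [|u s IH] /=; first by exists [::].
  by case/andP=> /codomP[x ->] /IH[d ->]; exists (x :: d).
move: size_c Uc cyc_c; rewrite cE size_map map_inj_uniq // => size_d Ud cyc_d.
have [|x [y [xd yd xy nxy nyx]]] := chG d _ size_d.
  rewrite /ucycle Ud andbT; move: cyc_d; case: (d) => //= a s.
  by rewrite -map_rcons path_map; apply: sub_path => u v /=; rewrite f_adj.
by exists (f x), (f y); split; rewrite ?map_f ?f_adj ?next_map ?(inj_eq f_inj).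
Qed.

Lemma clique_imset (K : {set G}) : clique K -> clique (f @: K).
Proof.
move=> clK _ _ /imsetP[x xK ->] /imsetP[y yK ->]; rewrite (inj_eq f_inj) f_adj.
exact: clK.
Qed.

Lemma clique_deletion_set_preimset p (D : {set H}) :
  clique_deletion_set p D -> clique_deletion_set p (f @^-1: D).
Proof.
move=> delD /has_clique_del_vertices[K [KD clK cardK]]; apply: delD.
apply/has_clique_del_vertices; exists (f @: K); split.
- by apply/subsetP => _ /imsetP[x /(subsetP KD) + ->]; rewrite !inE.
- exact: clique_imset.
- by rewrite card_imset.
Qed.

Lemma clique_deletion_set_imset p (W : {set G}) : 1 < p ->
  clique_deletion_set p W -> clique_deletion_set p (f @: W).
Proof.
move=> p_gt1 delW /has_clique_del_vertices[K [KW clK cardK]]; apply: delW.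
have Kf u : u \in K -> u \in codom f.
  move=> uK; have /card_gt0P[v] : 0 < #|K :\ u|.
    by move: p_gt1; rewrite -cardK (cardsD1 u) uK.
  rewrite !inE => /andP[vu vK]; apply: (f_edge (v := v)).
  by apply: clK; rewrite // eq_sym.
have preimK : f @: (f @^-1: K) = K.
  apply/setP => u; apply/imsetP/idP => [[x + ->]|uK]; first by rewrite inE.
  by have /codomP[x ux] := Kf u uK; exists x; rewrite // inE -ux.
apply/has_clique_del_vertices; exists (f @^-1: K); split.
- apply/subsetP => x; rewrite !inE => /(subsetP KW); rewrite inE.
  by apply: contra; apply: imset_f.
- move=> x y; rewrite !inE => xK yK xy; rewrite -f_adj; apply: clK => //.
  by rewrite (inj_eq f_inj).
- by rewrite -cardK -[in RHS]preimK card_imset.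
Qed.

Lemma min_clique_deletion_set_preimset p (D : {set H}) : 1 < p ->
  min_clique_deletion_set p D -> min_clique_deletion_set p (f @^-1: D).
Proof.
move=> p_gt1 [delD minD]; split; first exact: clique_deletion_set_preimset.
move=> W /(clique_deletion_set_imset p_gt1)/minD; rewrite card_imset //.
apply: leq_trans; rewrite -(card_imset _ f_inj); apply: subset_leq_card.
by apply/subsetP => _ /imsetP[x + ->]; rewrite inE.
Qed.

End IsolatedVertices.

Lemma nth_allpairs (S T R : Type) (f : S -> T -> R) s r x0 y0 z0 i j :
  i < size s -> j < size r ->
  nth z0 [seq f x y | x <- s, y <- r] (i * size r + j) =
  f (nth x0 s i) (nth y0 r j).
Proof.
move=> + ltj; elim: s i => [|x s IH] [|i] //= lti; rewrite nth_cat size_map.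
  by rewrite mul0n add0n ltj (nth_map y0).
by rewrite mulSn -addnA ltnNge leq_addr /= addKn IH.
Qed.

(* The vertices of [G] become the numbers below [#|G|], the other numbers below
   [N] being isolated vertices. *)
Section Padding.

Variables (G : sgraph) (N : nat).
Hypothesis leGN : #|G| <= N.

Definition padded_adj : rel 'I_N := fun x y =>
  match insub (val x) : option 'I_#|G|, insub (val y) : option 'I_#|G| with
  | Some i, Some j => adj (enum_val i) (enum_val j)
  | _, _ => false
  end.

Lemma padded_adj_sym : symmetric padded_adj.
Proof.
move=> x y; rewrite /padded_adj; do 2![case: insub => [?|] //].
exact: adj_sym.
Qed.

Lemma padded_adj_irr : irreflexive padded_adj.
Proof.
by move=> x; rewrite /padded_adj; case: insub => // i; apply: adj_irr.
Qed.

Definition padded_graph : sgraph := SGraph padded_adj_sym padded_adj_irr.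

Definition pad_vertex (x : G) : padded_graph := widen_ord leGN (enum_rank x).

Lemma pad_vertex_inj : injective pad_vertex.
Proof. by move=> x y [] /val_inj/enum_rank_inj. Qed.

Lemma padded_adj_vertex x y : adj (pad_vertex x) (pad_vertex y) = adj x y.
Proof. by rewrite /= /padded_adj /= !valK !enum_rankK. Qed.

Lemma padded_adj_lt (x y : padded_graph) : adj x y -> val x < #|G|.
Proof. by rewrite /= /padded_adj; case: insubP => // i ltx _. Qed.

Lemma padded_adj_codom (x y : padded_graph) : adj x y -> x \in codom pad_vertex.
Proof.
move/padded_adj_lt => ltx; apply/codomP; exists (enum_val (Ordinal ltx)).
by apply: val_inj; rewrite /= enum_valK.
Qed.

Lemma encode_vset_preimset (D : {set padded_graph}) :
  encode_vset (pad_vertex @^-1: D) = take #|G| (encode_vset D).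
Proof.
apply: (@eq_from_nth _ false) => [|i].
  by rewrite size_takel size_map -cardE ?card_ord.
rewrite size_map -cardE => lti.
have ltiN := leq_trans lti leGN; pose x0 := enum_val (Ordinal lti).
rewrite nth_take // (nth_map (Ordinal ltiN)) -?cardE ?card_ord //.
have vertexE : pad_vertex (enum_val (Ordinal lti)) =
    nth (Ordinal ltiN) (enum padded_graph) i.
  by apply: val_inj; rewrite /= enum_valK /= nth_enum_ord.
by rewrite (nth_map x0) -?cardE // inE -vertexE (enum_val_nth x0).
Qed.

Lemma heap_of_encode_graph (x y : 'I_N) : x < #|G| -> y < #|G| ->
  heap_of (encode_graph G) (x * #|G| + y) = padded_adj x y.
Proof.
move=> ltx lty; rewrite /heap_of /padded_adj !insubT; congr nat_of_bool.
have x0 := enum_val (Ordinal ltx).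
rewrite [in x * _]cardE (nth_allpairs _ x0 x0) -?cardE //.
by rewrite !(enum_val_nth x0).
Qed.

End Padding.

Theorem theorem7 (p : nat) (hp : 1 < p) :
  poly_time_solvable encode_graph encode_vset chordal
    (min_clique_deletion_set p).
Proof.
have [P [b [k runP]]] := compile_correct (CMain p.-1).
exists P, b, k => G chG; have [s le_s Ps] := runP (encode_graph G).
set N := size (encode_graph G) + 4 in Ps.
have sizeN : #|G| * #|G| + 4 = N by rewrite /N size_allpairs -cardE.
have leGN : #|G| <= N by nia.
have chH : chordal (padded_graph G N).
  apply: chordal_isolated chG; first exact: pad_vertex_inj leGN.
    exact: padded_adj_vertex.
  exact: padded_adj_codom.
have [||D [outE minD]] := @run_CMain N #|G| p.-1 _ _ _ sizeN
  (@padded_adj_lt G N) chH (fun=> N) (heap_of (encode_graph G)).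
- exact: heap_of_encode_graph.
- move=> u; rewrite inE /cell /heap_of nth_default //.
  apply: leq_trans (addr_ge _ _ _); rewrite /N ?leq_addr //.
  by rewrite addn4.
exists s, (pad_vertex leGN @^-1: D); split=> //.
  by rewrite encode_vset_preimset -outE.
rewrite -(prednK (ltnW hp)); apply: min_clique_deletion_set_preimset minD.
- exact: pad_vertex_inj.
- exact: padded_adj_vertex.
- exact: padded_adj_codom.
- by rewrite prednK // ltnW.
Qed.
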